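(* Let $\Gamma$ be a profinite group satisfying Mazur's condition $\Phi_p$, let $\overline\Theta$ be a continuous $k$-valued $G$-pseudocharacter of $\Gamma$, and let $Q$ be the quotient of $\Gamma$ attached to $\overline\Theta$ (defined in the context). Then $X^{\mathrm{gen},\Gamma}_{\overline\Theta}=X^{\mathrm{gen},Q}_{\overline\Theta}$; that is, for every $R^{\mathrm{ps},\Gamma}_{\overline\Theta}$-algebra $A$ the inclusion $X^{\mathrm{gen},Q}_{\overline\Theta}(A)\subset X^{\mathrm{gen},\Gamma}_{\overline\Theta}(A)$ given by inflation along $\Gamma\twoheadrightarrow Q$ is an equality.
   Context: $L$ is a finite extension of $\mathbb{Q}_p$ with ring of integers $\mathcal O$ and residue field $k$; $\bar k$ is an algebraic closure of $k$. $G$ is a generalised reductive group scheme over $\mathcal O$: a smooth affine group scheme with (not necessarily connected) reductive geometric fibres such that $G/G^0$ is finite, where $G^0$ is the neutral component. A profinite group $\Gamma$ satisfies Mazur's condition $\Phi_p$ if for every open subgroup $\Gamma'$ of $\Gamma$ the space $\mathrm{Hom}^{\mathrm{cont}}(\Gamma',\mathbb F_p)$ is finite. $G$-pseudocharacters: for a group $\Gamma$ and a commutative $\mathcal O$-algebra $A$, a $G$-pseudocharacter $\Theta$ of $\Gamma$ over $A$ is a sequence of $\mathcal O$-algebra maps $\Theta_n:\mathcal O[G^n]^{G^0}\to \mathrm{Map}(\Gamma^n,A)$, $n\ge1$ (invariants for the action induced by simultaneous conjugation), such that (1) for all $n,m\ge 1$, $\zeta:\{1,\dots,m\}\to\{1,\dots,n\}$,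 $f\in\mathcal O[G^m]^{G^0}$, $\gamma_i\in\Gamma$: $\Theta_n(f^\zeta)(\gamma_1,\dots,\gamma_n)=\Theta_m(f)(\gamma_{\zeta(1)},\dots,\gamma_{\zeta(m)})$, where $f^\zeta(g_1,\dots,g_n)=f(g_{\zeta(1)},\dots,g_{\zeta(m)})$; (2) for all $n\ge1$, $f\in\mathcal O[G^n]^{G^0}$, $\gamma_i\in\Gamma$: $\Theta_{n+1}(\hat f)(\gamma_1,\dots,\gamma_{n+1})=\Theta_n(f)(\gamma_1,\dots,\gamma_{n-1},\gamma_n\gamma_{n+1})$, where $\hat f(g_1,\dots,g_{n+1})=f(g_1,\dots,g_{n-1},g_ng_{n+1})$. For an $\mathcal O$-algebra map $A\to B$, $\Theta\otimes_AB$ denotes the composition of $\Theta$ with $A\to B$. $\Theta$ is continuous if all $\Theta_n$ take values in continuous maps $\Gamma^n\to A$ (for $\Gamma$ a topological group, $A$ a topological ring). To $\rho:\Gamma\to G(A)$ one attaches $\Theta_\rho$ by $\Theta_{\rho,m}(f)(\gamma_1,\dots,\gamma_m)=f(\rho(\gamma_1),\dots,\rho(\gamma_m))$. Deformation ring: let $\mathfrak A_{\mathcal O}$ be the category of artinian local $\mathcal O$-algebras with residue field $k$. The functor sending $A\in\mathfrak A_{\mathcal O}$ to the set of continuous $A$-valued $G$-pseudocharacters $\Theta$ of $\Gamma$ with $\Theta\otimes_Ak=\overline\Theta$ is pro-represented by a local profinite $\mathcal O$-algebra $R^{\mathrm{ps},\Gamma}_{\overline\Theta}$ with residue field $k$;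 it carries the universal deformation $\Theta^u$. Under $\Phi_p$ this ring is noetherian. The quotient $Q$: choose a continuous representation $\overline\rho:\Gamma\to G(\bar k)$ with $\Theta_{\overline\rho}=\overline\Theta\otimes_k\bar k$ (one exists), let $K=\ker\overline\rho$, let $K(p)$ be the maximal pro-$p$ quotient of $K$, and let $Q$ be the quotient of $\Gamma$ fitting into $0\to K(p)\to Q\to\Gamma/K\to0$. It does not depend on the choice of $\overline\rho$; $\overline\Theta$ factors through $Q$, and the natural map $R^{\mathrm{ps},\Gamma}_{\overline\Theta}\to R^{\mathrm{ps},Q}_{\overline\Theta}$ is an isomorphism, by which the two rings are identified. Condensed representations: let $R$ be a profinite noetherian $\mathcal O$-algebra. Every finitely generated $R$-module has a unique Hausdorff topology making it a topological $R$-module. For an $R$-algebra $A$, a representation $\rho:\Gamma\to G(A)$ is $R$-condensed if there exist a closed immersion of $\mathcal O$-schemes $\tau:G\hookrightarrow\mathbb A^n$ and a finitely generated $R$-submodule $M\subset \mathbb A^n(A)=A^n$ such that $\tau(\rho(\Gamma))\subset M$ and $\tau\circ\rho:\Gamma\to M$ is continuous for the canonical topology of $M$. For an $R^{\mathrm{ps}}_{\overline\Theta}$-algebra $A$, $X^{\mathrm{gen},\Gamma}_{\overline\Theta}(A)$ is the set of $R^{\mathrm{ps}}_{\overline\Theta}$-condensed representations $\rho:\Gamma\to G(A)$ with $\Theta_\rho=\Theta^u\otimes_{R^{\mathrm{ps}}_{\overline\Theta}}A$; $X^{\mathrm{gen},Q}_{\overline\Theta}(A)$ is defined in the same way with $Q$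 in place of $\Gamma$. *)

(* Defs.v *)
From HB Require Import structures.
From mathcomp Require Import all_boot all_order all_algebra all_field.
From mathcomp Require Import all_classical all_reals all_analysis.

Set Implicit Arguments.
Unset Strict Implicit.
Unset Printing Implicit Defensive.

Import Order.TTheory GRing.Theory Num.Theory.

Local Open Scope classical_set_scope.
Local Open Scope ring_scope.

HB.mixin Record isTopologicalGroup G & Topological G & Group G := {
  mulg_continuous : continuous (fun x : G * G => (x.1 * x.2)%g) ;
  invg_continuous : continuous (fun x : G => (x^-1)%g) }.

#[short(type="topGroupType")]
HB.structure Definition TopGroup :=
  {G of Topological G & Group G & isTopologicalGroup G}.

HB.mixin Record isTopologicalComRing R
    & TopologicalZmodule R & GRing.ComPzRing R := {
  mulr_continuous : continuous (fun x : R * R => x.1 * x.2) }.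

#[short(type="topComRingType")]
HB.structure Definition TopComRing :=
  {R of TopologicalZmodule R & GRing.ComPzRing R & isTopologicalComRing R}.

Definition profinite (T : topologicalType) : Prop :=
  [/\ compact [set: T], hausdorff_space T & totally_disconnected [set: T]].

Definition subgroup (G : groupType) (H : set G) : Prop :=
  [/\ H 1%g, forall x y, H x -> H y -> H (x * y)%g
    & forall x, H x -> H (x^-1)%g].

Definition normalised_by (G : groupType) (K H : set G) : Prop :=
  forall x h, K x -> H h -> H (x * h * x^-1)%g.

(* A discrete valuation, with values recorded on nonzero elements only: [v 0]
   is a junk value, and [vge v n x] says that the valuation of [x] is at
   least [n], with the valuation of 0 infinite. *)
Definition is_valuation (K : fieldType) (v : K -> int) : Prop :=
  (forall x y, x != 0 -> y != 0 -> v (x * y) = v x + v y) /\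
  (forall x y, x != 0 -> y != 0 -> x + y != 0 ->
     Order.min (v x) (v y) <= v (x + y)).

Definition vge (K : fieldType) (v : K -> int) (n : int) (x : K) : Prop :=
  x = 0 \/ n <= v x.

(* Q_p is the completion of the field of rational numbers for the p-adic
   valuation. *)
Definition is_Qp (p : nat) (K : fieldType) (v : K -> int) : Prop :=
  [/\ is_valuation v,
      forall n : nat, (0 < n)%N -> n%:R != 0 :> K /\ v n%:R = (logn p n)%:Z,
      forall (x : K) (N : int), exists q : rat, vge v N (x - ratr q)
    & forall u : nat -> K,
        (forall N : int, exists n0 : nat, forall m n : nat,
           (n0 <= m)%N -> (n0 <= n)%N -> vge v N (u m - u n)) ->
        exists l : K, forall N : int, exists n0 : nat, forall n : nat,
           (n0 <= n)%N -> vge v N (u n - l)].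

(* [O], via [iota], is the valuation ring of the finite extension [L] of
   [Qp], where [v] is the normalised valuation of [L]. *)
Definition is_ring_of_integers (Qp : fieldType) (vp : Qp -> int)
    (L : fieldExtType Qp) (v : L -> int)
    (O : idomainType) (iota : {rmorphism O -> L}) : Prop :=
  [/\ is_valuation v, exists2 w : L, w != 0 & v w = 1,
      exists2 e : nat, (0 < e)%N &
        forall x : Qp, x != 0 -> v (x%:A) = e%:Z * vp x,
      injective iota
    & forall x : L, (exists y, iota y = x) <-> vge v 0 x].

(* Over an arbitrary commutative ring, the zero algebra being allowed, and
   with structure maps that compose. *)
Record Alg (S : comPzRingType) := mkAlg {
  car :> comPzRingType;
  str : {rmorphism S -> car} }.
Arguments mkAlg {S car} str.

Record algHom (S : comPzRingType) (A B : Alg S) := AlgHom {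
  alghom_fun :> {rmorphism A -> B};
  alghom_str : forall s, alghom_fun (str A s) = str B s }.

Lemma algHom_eq (S : comPzRingType) (A B : Alg S) (f g : algHom A B) :
  f =1 g -> f = g.
Proof.
case: f g => [[f [[fB] [[f1 fM]]]] fs] [[g [[gB] [[g1 gM]]]] gs] /= /funext e.
subst g; rewrite (Prop_irrelevance gB fB) (Prop_irrelevance g1 f1) in gs *.
rewrite (Prop_irrelevance gM fM) in gs *.
by congr AlgHom; exact: Prop_irrelevance.
Qed.

Definition algComp (S : comPzRingType) (A B C : Alg S)
    (g : algHom B C) (f : algHom A B) : algHom A C.
Proof.
by exists (g \o f : {rmorphism A -> C}) => s /=; rewrite !alghom_str.
Defined.

Definition extendHom (S : comPzRingType) (A B : comPzRingType)
    (i : {rmorphism S -> A}) (f : {rmorphism A -> B}) :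
  algHom (mkAlg i) (mkAlg (f \o i)) := @AlgHom _ (mkAlg i) (mkAlg (f \o i)) f
    (fun=> erefl).

Definition restrictScalars (S : comPzRingType) (A : Alg S) (B : Alg A) :
  Alg S := mkAlg (str B \o str A).

(* [poly_eval f x] is the value at [x] of the polynomial in [n] variables
   given by the list [f] of its terms (coefficient, exponents). *)
Definition poly_eval (S : comPzRingType) (A : Alg S) (n : nat)
    (f : seq (S * ('I_n -> nat))) (x : 'I_n -> A) : A :=
  \sum_(c <- f) str A c.1 * \prod_(i < n) x i ^+ c.2 i.

Definition generates (S : comPzRingType) (A : Alg S) (n : nat)
    (x : 'I_n -> A) : Prop :=
  forall a : A, exists f, a = poly_eval f x.

(* [A] is the quotient of the polynomial ring in [n] variables by the ideal
   generated by the finite family [fs]. *)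
Definition finitely_presented (S : comPzRingType) (A : Alg S) : Prop :=
  exists (n : nat) (x : 'I_n -> A) (m : nat)
         (fs : 'I_m -> seq (S * ('I_n -> nat))),
    (forall j, poly_eval (fs j) x = 0) /\
    forall (B : Alg S) (y : 'I_n -> B),
      (forall j, poly_eval (fs j) y = 0) ->
      exists! g : algHom A B, forall i, g (x i) = y i.

Definition square_zero_surjection (S : comPzRingType) (B B0 : Alg S)
    (q : algHom B B0) : Prop :=
  (forall b0, exists b, q b = b0) /\
  (forall x y, q x = 0 -> q y = 0 -> x * y = 0).

Definition smooth (S : comPzRingType) (A : Alg S) : Prop :=
  finitely_presented A /\
  forall (B B0 : Alg S) (q : algHom B B0) (f0 : algHom A B0),
    square_zero_surjection q ->
    exists f : algHom A B, algComp q f = f0.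

Definition etale (S : comPzRingType) (A : Alg S) : Prop :=
  finitely_presented A /\
  forall (B B0 : Alg S) (q : algHom B B0) (f0 : algHom A B0),
    square_zero_surjection q ->
    exists! f : algHom A B, algComp q f = f0.

Definition module_finite (S : comPzRingType) (A : Alg S) : Prop :=
  exists (d : nat) (a : 'I_d -> A), forall x : A,
    exists r : 'I_d -> S, x = \sum_(i < d) str A (r i) * a i.

Definition is_ideal (A : comPzRingType) (I : set A) : Prop :=
  [/\ I 0, forall x y, I x -> I y -> I (x + y)
    & forall a x, I x -> I (a * x)].

Definition is_prime (A : comPzRingType) (P : set A) : Prop :=
  [/\ is_ideal P, ~ P 1 & forall x y, P (x * y) -> P x \/ P y].

Definition spec_surjective (S : comPzRingType) (A : Alg S) : Prop :=
  forall P : set S, is_prime P ->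
    exists2 P' : set A, is_prime P' & str A @^-1` P' = P.

Definition artinian (A : comPzRingType) : Prop :=
  forall I : nat -> set A, (forall n, is_ideal (I n)) ->
    (forall n, I n.+1 `<=` I n) ->
    exists n0, forall n, (n0 <= n)%N -> I n = I n0.

(* [A] is local and [q] identifies its residue field with [k]. *)
Definition local_with_residue (S : comPzRingType) (A k : Alg S)
    (q : algHom A k) : Prop :=
  (forall c, exists a, q a = c) /\
  (forall a, q a <> 0 -> exists b, a * b = 1).

(* An affine group scheme over [O] is given by its coordinate ring and a group
   law on its functor of points [A |-> Hom_O(O[G], A)], natural in [A]. The
   unit and the inverse are then automatically natural. *)
Record affineGroup (O : comPzRingType) := AffineGroup {
  coordRing : Alg O;
  pt_mul : forall A : Alg O, algHom coordRing A -> algHom coordRing A -> algHom coordRing A;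
  pt_one : forall A : Alg O, algHom coordRing A;
  pt_inv : forall A : Alg O, algHom coordRing A -> algHom coordRing A;
  pt_mul_nat : forall (A B : Alg O) (f : algHom A B) (g h : algHom coordRing A),
    algComp f (pt_mul g h) = pt_mul (algComp f g) (algComp f h);
  pt_mulA : forall A, associative (@pt_mul A);
  pt_mul1g : forall A, left_id (pt_one A) (@pt_mul A);
  pt_mulg1 : forall A, right_id (pt_one A) (@pt_mul A);
  pt_mulVg : forall A, left_inverse (pt_one A) (@pt_inv A) (@pt_mul A);
  pt_mulgV : forall A, right_inverse (pt_one A) (@pt_inv A) (@pt_mul A) }.

Definition points (O : comPzRingType) (G : affineGroup O) (A : Alg O) : Type :=
  algHom (coordRing G) A.

HB.instance Definition _ O (G : affineGroup O) A :=
  gen_eqMixin (points G A).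
HB.instance Definition _ O (G : affineGroup O) A :=
  gen_choiceMixin (points G A).
HB.instance Definition _ O (G : affineGroup O) A :=
  isGroup.Build (points G A) (@pt_mulA O G A) (@pt_mul1g O G A)
    (@pt_mulg1 O G A) (@pt_mulVg O G A) (@pt_mulgV O G A).

Definition pt_fun (O : comPzRingType) (G : affineGroup O) (A : Alg O)
    (g : points G A) : algHom (coordRing G) A := g.

Definition pt_map (O : comPzRingType) (G : affineGroup O) (A B : Alg O)
    (f : algHom A B) (g : points G A) : points G B := algComp f g.

(* Over an algebraically closed field [A], the functions on [G(A)] given by
   the elements of O[G] (x) A. *)
Definition fibre_fun (O : comPzRingType) (G : affineGroup O) (A : Alg O)
    (s : seq (A * coordRing G)) (x : points G A) : A :=
  \sum_(c <- s) c.1 * pt_fun x c.2.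

(* [points G A] with the Zariski topology. It is used for [A] an algebraically
   closed field and [G] smooth; the geometric fibre is then reduced, hence
   determined by its rational points. *)
Definition zariski (O : comPzRingType) (G : affineGroup O) (A : Alg O) : Type :=
  points G A.

HB.instance Definition _ O (G : affineGroup O) A := Group.on (zariski G A).
HB.instance Definition _ O (G : affineGroup O) A :=
  isSubBaseTopological.Build (zariski G A)
    [set U : set (zariski G A) |
      exists s, U = [set x | fibre_fun s x <> 0]] id.

(* The neutral component as a subfunctor of [G]: the points all of whose
   geometric fibres lie in the neutral component of the fibre. *)
Definition neutral (O : comPzRingType) (G : affineGroup O) (A : Alg O) :
    set (points G A) :=
  [set g | forall (K : closedFieldType) (t : {rmorphism O -> K})
             (s : algHom A (mkAlg t)),
     connected_component [set: zariski G (mkAlg t)] 1%g (pt_map s g)].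

(* [g] is unipotent: [rho_g - 1] is locally nilpotent on regular functions,
   where [rho_g] is right translation by [g]. *)
Definition unipotent (O : comPzRingType) (G : affineGroup O) (A : Alg O)
    (g : points G A) : Prop :=
  forall s : seq (A * coordRing G), exists n : nat, forall x : points G A,
    iter n (fun (F : points G A -> A) (y : points G A) => F (y * g)%g - F y)
      (fibre_fun s) x = 0.

Definition reductive_geometric_fibres (O : comPzRingType)
    (G : affineGroup O) : Prop :=
  forall (K : closedFieldType) (t : {rmorphism O -> K})
         (H : set (zariski G (mkAlg t))),
    closed H -> connected H -> subgroup H -> normalised_by setT H ->
    (forall g, H g -> unipotent g) -> H = [set 1%g].

(* The etale sheaf quotient of [G] by its neutral component is represented by
   a finite [O]-scheme Spec [C]. *)
Definition finite_component_quotient (O : comPzRingType)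
    (G : affineGroup O) : Prop :=
  exists (C : Alg O) (pr : algHom C (coordRing G)),
    [/\ module_finite C,
        forall (A : Alg O) (g h : points G A),
          algComp g pr = algComp h pr <-> neutral (g^-1 * h)%g
      & forall (A : Alg O) (x : algHom C A),
          exists (A' : Alg A) (g : points G (restrictScalars A')),
            [/\ etale A', spec_surjective A'
              & forall c, pt_fun g (pr c) = str A' (x c)]].

Definition generalised_reductive (O : comPzRingType) (G : affineGroup O) :
    Prop :=
  [/\ smooth (coordRing G), reductive_geometric_fibres G
    & finite_component_quotient G].

(* O[G^n], as the set of morphisms of functors from G^n to the affine line. *)
Record regFun (O : comPzRingType) (G : affineGroup O) (n : nat) := RegFun {
  ev :> forall A : Alg O, ('I_n -> points G A) -> A;
  ev_nat : forall (A B : Alg O) (f : algHom A B) (g : 'I_n -> points G A),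
    ev (fun i => pt_map f (g i)) = f (ev g) }.

Definition conj_invariant (O : comPzRingType) (G : affineGroup O) (n : nat)
    (f : regFun G n) : Prop :=
  forall (A : Alg O) (h : points G A) (g : 'I_n -> points G A),
    neutral h -> f A (fun i => h * g i * h^-1)%g = f A g.

Record invFun (O : comPzRingType) (G : affineGroup O) (n : nat) := InvFun {
  inv_fun :> regFun G n;
  inv_funP : conj_invariant inv_fun }.

(* (g_1, ..., g_{n+2}) |-> (g_1, ..., g_n, g_{n+1} g_{n+2}) *)
Definition merge_last (X : groupType) (n : nat) (g : 'I_n.+2 -> X)
    (i : 'I_n.+1) : X :=
  let gi := g (widen_ord (leqnSn n.+1) i) in
  if i == ord_max then (gi * g ord_max)%g else gi.

Section InvariantFunctions.
Context (O : comPzRingType) (G : affineGroup O).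

Lemma pt_mapM (A B : Alg O) (f : algHom A B) (g h : points G A) :
  pt_map f (g * h)%g = (pt_map f g * pt_map f h)%g.
Proof. exact: pt_mul_nat. Qed.

Program Definition inv_const n (c : O) : invFun G n :=
  @InvFun _ _ _ (@RegFun _ _ _ (fun A _ => str A c) _) _.
Next Obligation. by move=> n c A B f g; rewrite alghom_str. Qed.
Next Obligation. by []. Qed.

Program Definition inv_add n (f1 f2 : invFun G n) : invFun G n :=
  @InvFun _ _ _ (@RegFun _ _ _ (fun A g => f1 A g + f2 A g) _) _.
Next Obligation. by move=> *; rewrite rmorphD !ev_nat. Qed.
Next Obligation. by move=> n f1 f2 A h g hh /=; rewrite !inv_funP. Qed.

Program Definition inv_mul n (f1 f2 : invFun G n) : invFun G n :=
  @InvFun _ _ _ (@RegFun _ _ _ (fun A g => f1 A g * f2 A g) _) _.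
Next Obligation. by move=> *; rewrite rmorphM !ev_nat. Qed.
Next Obligation. by move=> n f1 f2 A h g hh /=; rewrite !inv_funP. Qed.

Program Definition inv_reindex m n (zeta : 'I_m -> 'I_n) (f : invFun G m) :
    invFun G n :=
  @InvFun _ _ _ (@RegFun _ _ _ (fun A g => f A (g \o zeta)) _) _.
Next Obligation. by move=> *; rewrite -ev_nat. Qed.
Next Obligation. by move=> m n zeta f A h g hh /=; rewrite -[RHS](inv_funP f _ hh). Qed.

Program Definition inv_merge n (f : invFun G n.+1) : invFun G n.+2 :=
  @InvFun _ _ _ (@RegFun _ _ _ (fun A g => f A (merge_last g)) _) _.
Next Obligation.
move=> n f A B phi g; rewrite -ev_nat; congr (ev f _); apply/funext => i.
by rewrite /merge_last; case: ifP => // _; rewrite pt_mapM.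
Qed.
Next Obligation.
move=> n f A h g hh /=; rewrite -[RHS](inv_funP f _ hh); congr (ev f _).
apply/funext => i; rewrite /merge_last; case: ifP => // _.
by rewrite !mulgA mulgVK.
Qed.

End InvariantFunctions.

(* The map attached to n+1 >= 1 is [pc_fun n]. *)
Record pseudochar (O : comPzRingType) (G : affineGroup O) (Gamma : groupType)
    (A : Alg O) := Pseudochar {
  pc_fun :> forall n : nat, invFun G n.+1 -> ('I_n.+1 -> Gamma) -> A;
  pc_const : forall n c gamma, pc_fun (inv_const G n.+1 c) gamma = str A c;
  pc_add : forall n (f1 f2 : invFun G n.+1) gamma,
    pc_fun (inv_add f1 f2) gamma = pc_fun f1 gamma + pc_fun f2 gamma;
  pc_mul : forall n (f1 f2 : invFun G n.+1) gamma,
    pc_fun (inv_mul f1 f2) gamma = pc_fun f1 gamma * pc_fun f2 gamma;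
  pc_reindex : forall n m (zeta : 'I_m.+1 -> 'I_n.+1) (f : invFun G m.+1) gamma,
    pc_fun (inv_reindex zeta f) gamma = pc_fun f (gamma \o zeta);
  pc_merge : forall n (f : invFun G n.+1) (gamma : 'I_n.+2 -> Gamma),
    pc_fun (inv_merge f) gamma = pc_fun f (merge_last gamma) }.

Definition pc_eq (O : comPzRingType) (G : affineGroup O) (Gamma : groupType)
    (A : Alg O) (Th1 Th2 : pseudochar G Gamma A) : Prop :=
  forall n (f : invFun G n.+1) gamma, Th1 n f gamma = Th2 n f gamma.

(* [tau] is the family of open subsets of [A]; [setT] gives the discrete
   topology. *)
Definition pc_continuous (O : comPzRingType) (G : affineGroup O)
    (Gamma : topGroupType) (A : Alg O) (tau : set (set A))
    (Th : pseudochar G Gamma A) : Prop :=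
  forall n (f : invFun G n.+1) (U : set A), tau U ->
    open ((Th n f : {ptws 'I_n.+1 -> Gamma} -> A) @^-1` U).

Section PseudocharOperations.
Context (O : comPzRingType) (G : affineGroup O).

Program Definition pc_base_change (Gamma : groupType) (A B : Alg O)
    (phi : algHom A B) (Th : pseudochar G Gamma A) : pseudochar G Gamma B :=
  @Pseudochar _ _ _ _ (fun n f gamma => phi (Th n f gamma)) _ _ _ _ _.
Next Obligation. by move=> * /=; rewrite pc_const alghom_str. Qed.
Next Obligation. by move=> * /=; rewrite pc_add rmorphD. Qed.
Next Obligation. by move=> * /=; rewrite pc_mul rmorphM. Qed.
Next Obligation. by move=> * /=; rewrite pc_reindex. Qed.
Next Obligation. by move=> * /=; rewrite pc_merge. Qed.

Lemma merge_last_morph (X Y : groupType) (h : X -> Y) n (g : 'I_n.+2 -> X) :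
  {morph h : x y / (x * y)%g} -> h \o merge_last g = merge_last (h \o g).
Proof.
by move=> hM; apply/funext => i; rewrite /merge_last /=; case: ifP.
Qed.

Program Definition pc_inflation (Gamma Q : groupType) (A : Alg O)
    (pi : Gamma -> Q) (piM : {morph pi : x y / (x * y)%g})
    (Th : pseudochar G Q A) : pseudochar G Gamma A :=
  @Pseudochar _ _ _ _ (fun n f gamma => Th n f (pi \o gamma)) _ _ _ _ _.
Next Obligation. by move=> * /=; rewrite pc_const. Qed.
Next Obligation. by move=> * /=; rewrite pc_add. Qed.
Next Obligation. by move=> * /=; rewrite pc_mul. Qed.
Next Obligation. by move=> * /=; rewrite pc_reindex. Qed.
Next Obligation. by move=> * /=; rewrite pc_merge merge_last_morph. Qed.

Program Definition pc_of_rep (Gamma : groupType) (A : Alg O)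
    (rho : Gamma -> points G A) (rhoM : {morph rho : x y / (x * y)%g}) :
    pseudochar G Gamma A :=
  @Pseudochar _ _ _ _ (fun n f gamma => f A (rho \o gamma)) _ _ _ _ _.
Next Obligation. by []. Qed.
Next Obligation. by []. Qed.
Next Obligation. by []. Qed.
Next Obligation. by []. Qed.
Next Obligation. by move=> * /=; rewrite merge_last_morph. Qed.

End PseudocharOperations.

Definition mazur_Phi (p : nat) (Gamma : topGroupType) : Prop :=
  forall H : set Gamma, open H -> subgroup H ->
    (* continuous homomorphisms from [H] to F_p, extended by 0 *)
    finite_set [set f : Gamma -> 'F_p |
      [/\ forall x y, H x -> H y -> f (x * y)%g = f x + f y,
          forall a, open (H `&` f @^-1` [set a])
        & forall x, ~ H x -> f x = 0]].

(* [R] pro-represents the functor of continuous deformations of [Thbar] to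
   artinian local [O]-algebras with residue field [k], and [Thu] is the
   universal deformation. An [O]-algebra map from [R] to such an algebra is
   automatically compatible with the maps to [k]. *)
Definition is_universal_deformation (O : comPzRingType) (G : affineGroup O)
    (Gamma : topGroupType) (k : Alg O) (Thbar : pseudochar G Gamma k)
    (R : topComRingType) (iR : {rmorphism O -> R})
    (r : algHom (mkAlg iR) k) (Thu : pseudochar G Gamma (mkAlg iR)) : Prop :=
  [/\ profinite R,
      local_with_residue r,
      pc_continuous (A := mkAlg iR) (@open R) Thu,
      pc_eq (pc_base_change r Thu) Thbar
    & forall (A : Alg O) (q : algHom A k) (Th : pseudochar G Gamma A),
        artinian A -> local_with_residue q ->
        pc_continuous setT Th -> pc_eq (pc_base_change q Th) Thbar ->
        exists! phi : algHom (mkAlg iR) A,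
          (forall U : set A, open ((phi : R -> A) @^-1` U)) /\
          pc_eq (pc_base_change phi Thu) Th].

(* The kernel of the map from [K] to its maximal pro-p quotient: the
   intersection of the open normal subgroups [U] of [K] such that [K/U] is a
   p-group. *)
Definition pro_p_kernel (p : nat) (Gamma : topGroupType) (K : set Gamma) :
    set Gamma :=
  \bigcap_(U in [set U : set Gamma |
    [/\ subgroup U, normalised_by K U,
        exists2 V : set Gamma, open V & U = K `&` V
      & forall g, K g -> exists e : nat, U (g ^+ (p ^ e))%g]]) U.

(* [Q], via [pi], is the quotient of [Gamma] by the kernel of the map from
   ker [rhobar] to its maximal pro-p quotient; it has the quotient topology
   because [Gamma] is compact. *)
Definition is_pro_p_quotient (p : nat) (Gamma Q : topGroupType) (X : groupType)
    (rhobar : Gamma -> X) (pi : Gamma -> Q) : Prop :=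
  [/\ profinite Q, continuous pi, forall q, exists g, pi g = q
    & pi @^-1` [set 1%g] = pro_p_kernel p (rhobar @^-1` [set 1%g])].

(* [a] makes [A] an [R]-algebra. A closed immersion of [G] into the affine
   [n]-space is a family [tau] of [n] generators of O[G]. [M], embedded by
   [incl], is a finitely generated [R]-submodule of [A^n] with a Hausdorff
   topology making it a topological [R]-module; the module axioms are
   inherited from [A^n]. Such a topology is unique: for [R] compact, it is the
   quotient topology from [R^d]. *)
Definition condensed (O : comPzRingType) (G : affineGroup O)
    (Gamma : topGroupType) (R : topComRingType) (iR : {rmorphism O -> R})
    (A : Alg O) (a : algHom (mkAlg iR) A) (rho : Gamma -> points G A) : Prop :=
  exists (n : nat) (tau : 'I_n -> coordRing G),
    generates tau /\
    exists (M : topologicalZmodType) (scale : R -> M -> M)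
           (incl : M -> 'I_n -> A),
      [/\ hausdorff_space M,
          continuous (fun x : R * M => scale x.1 x.2),
          [/\ injective incl,
              forall x y i, incl (x + y) i = incl x i + incl y i
            & forall r x i, incl (scale r x) i = a r * incl x i],
          exists (d : nat) (m : 'I_d -> M), forall x : M,
            exists c : 'I_d -> R, x = \sum_(j < d) scale (c j) (m j)
        & exists2 c : Gamma -> M, continuous c &
            forall gamma i, incl (c gamma) i = pt_fun (rho gamma) (tau i)].

(* The set X^gen(A), where [R] is the deformation ring with universal
   deformation [Thu], and [a] makes [A] an [R]-algebra. *)
Definition Xgen (O : comPzRingType) (G : affineGroup O)
    (Gamma : topGroupType) (R : topComRingType) (iR : {rmorphism O -> R})
    (Thu : pseudochar G Gamma (mkAlg iR)) (A : Alg O)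
    (a : algHom (mkAlg iR) A) (rho : Gamma -> points G A) : Prop :=
  exists rhoM : {morph rho : x y / (x * y)%g},
    condensed a rho /\ pc_eq (pc_of_rep rhoM) (pc_base_change a Thu).

(* Main.v *)
(* Let [B = O[G]]. Smoothness makes [B] torsion-free over the discrete valuation
   ring [O]; hence finitely many functions on [G] lie in a free comodule of finite
   rank [d]. The coefficients of the characteristic polynomial of [g] in this
   comodule are invariant functions on [G], so the pseudocharacter determines
   their values at [rho g], and Cayley-Hamilton gives a relation, with
   coefficients in [R], between the vectors [c (y g^j z)] of the module [M] that
   contains the image [c] of [rho]. For [g] in the kernel of [rhobar] the
   polynomial is [(X - 1)^d] modulo the maximal ideal of [R]. For an open ideal
   [I] of [R] it follows that translation by [g] is unipotent modulo [I M], so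
   that a power [g^(p^e)] acts trivially. Thus the elements of the kernel that act
   trivially modulo [I M] form one of the subgroups whose intersection is the
   kernel of the map to the maximal pro-p quotient. As the submodules [I M]
   intersect in 0, [rho] is trivial on that intersection. *)

Require Import Defs.
From HB Require Import structures.
From mathcomp Require Import all_boot all_order all_algebra all_field.
From mathcomp Require Import all_classical all_reals all_analysis.
From mathcomp Require Import zify ring.

Set Implicit Arguments.
Unset Strict Implicit.
Unset Printing Implicit Defensive.

Import Order.TTheory GRing.Theory Num.Theory.

Local Open Scope classical_set_scope.
Local Open Scope ring_scope.

(** [A] carries no topology and need not be noetherian, and translation by [rho g] need not preserve
    [M]. What acts is the map (y, z) |-> (y g, z) of [Gamma * Gamma], on functions with values in
    [M]; it is applied to (y, z) |-> c (y z). The free arguments on both sides of g also absorb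
    conjugation, so that the elements acting trivially modulo I M form a normal subgroup.

    Being an arbitrary O-algebra, [A] may have torsion or be zero, and independence over O is lost
    in it. Identities between matrix coefficients are therefore proved at universal points, with
    values in tensor products of copies of O[G], and then specialised.

    A p-power of a unipotent operator becomes trivial modulo I M because p is itself nilpotent
    modulo I: it vanishes in k, and in a compact local ring every element of the maximal ideal is
    nilpotent modulo each open ideal. *)

(** * Quotients of commutative rings *)

Section RingMorphism.
Context (A B : pzRingType) (f : A -> B).
Hypotheses (fD : {morph f : x y / x + y}) (fM : {morph f : x y / x * y})
  (f1 : f 1 = 1).

Lemma mk_rmorphism_zmod : zmod_morphism f.
Proof. by move=> x y; apply: (addIr (f y)); rewrite -fD !subrK. Qed.

Definition mk_rmorphism : {rmorphism A -> B} :=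
  HB.pack_for {rmorphism A -> B} f
    (GRing.isZmodMorphism.Build A B f mk_rmorphism_zmod)
    (GRing.isMonoidMorphism.Build A B f (f1, fM)).

Lemma mk_rmorphismE x : mk_rmorphism x = f x. Proof. by []. Qed.
End RingMorphism.

Section Quotient.
Context (X : Type) (eqv : X -> X -> Prop) (add mul : X -> X -> X)
  (opp : X -> X) (zero one : X).
Hypotheses (eqvxx : forall x, eqv x x)
  (eqvC : forall x y, eqv x y -> eqv y x)
  (eqvT : forall x y z, eqv x y -> eqv y z -> eqv x z)
  (addE : forall x x' y, eqv x x' -> eqv (add x y) (add x' y))
  (mulE : forall x x' y, eqv x x' -> eqv (mul x y) (mul x' y))
  (oppE : forall x x', eqv x x' -> eqv (opp x) (opp x'))
  (addA : forall x y z, eqv (add x (add y z)) (add (add x y) z))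
  (addC : forall x y, eqv (add x y) (add y x))
  (add0 : forall x, eqv (add zero x) x)
  (addN : forall x, eqv (add (opp x) x) zero)
  (mulA : forall x y z, eqv (mul x (mul y z)) (mul (mul x y) z))
  (mulC : forall x y, eqv (mul x y) (mul y x))
  (mul1 : forall x, eqv (mul one x) x)
  (mulD : forall x y z, eqv (mul (add x y) z) (add (mul x z) (mul y z))).

Let Q := {S : set X | exists x, S = eqv x}.

Let cls (x : X) : Q := exist _ (eqv x) (ex_intro _ x erefl).

Let cls_eq x y : (cls x = cls y) <-> eqv x y.
Proof.
split=> [[e]|e]; first by rewrite e.
suff E : eqv x = eqv y.
  rewrite /cls; case: _ / E (ex_intro _ y _) => e'; congr exist; exact: Prop_irrelevance.
apply/funext => z; apply/propext; split; first exact: eqvT (eqvC e).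
exact: eqvT.
Qed.

Let rep (q : Q) : X := projT1 (cid (proj2_sig q)).

Let repK : cancel rep cls.
Proof.
case=> S h; rewrite /rep /=; case: cid => x /= e.
rewrite /cls; subst S; congr exist; exact: Prop_irrelevance.
Qed.

Let clsK x : eqv (rep (cls x)) x. Proof. by apply/cls_eq; rewrite repK. Qed.

Let addE' x x' y y' : eqv x x' -> eqv y y' -> eqv (add x y) (add x' y').
Proof.
move=> h h'; apply: eqvT (addE _ h) _; apply: eqvT (addC _ _) _.
by apply: eqvT (addE _ h') _; exact: addC.
Qed.

Let mulE' x x' y y' : eqv x x' -> eqv y y' -> eqv (mul x y) (mul x' y').
Proof.
move=> h h'; apply: eqvT (mulE _ h) _; apply: eqvT (mulC _ _) _.
by apply: eqvT (mulE _ h') _; exact: mulC.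
Qed.

Let qadd (a b : Q) := cls (add (rep a) (rep b)).
Let qmul (a b : Q) := cls (mul (rep a) (rep b)).
Let qopp (a : Q) := cls (opp (rep a)).

Let qaddE x y : qadd (cls x) (cls y) = cls (add x y).
Proof. by apply/cls_eq/addE'. Qed.
Let qmulE x y : qmul (cls x) (cls y) = cls (mul x y).
Proof. by apply/cls_eq/mulE'. Qed.
Let qoppE x : qopp (cls x) = cls (opp x).
Proof. exact/cls_eq/oppE. Qed.

(** The operations on [X] satisfy the ring axioms only up to [eqv], as formal sums of tensors do.
    Compatibility in the first argument is enough, by commutativity. *)
Lemma quotient_ring : exists (q : comPzRingType) (c : X -> q),
  [/\ forall a, exists x, a = c x,
      forall x y, c x = c y <-> eqv x y,
      {morph c : x y / add x y >-> x + y},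
      {morph c : x y / mul x y >-> x * y}
    & c one = 1 /\ forall x, c (opp x) = - c x].
Proof.
have A1 : associative qadd.
  move=> a b c; rewrite -(repK a) -(repK b) -(repK c) !qaddE; exact/cls_eq.
have A2 : commutative qadd.
  by move=> a b; rewrite -(repK a) -(repK b) !qaddE; exact/cls_eq.
have A3 : left_id (cls zero) qadd.
  by move=> a; rewrite -(repK a) !qaddE; exact/cls_eq.
have A4 : left_inverse (cls zero) qopp qadd.
  by move=> a; rewrite -(repK a) !qoppE qaddE; exact/cls_eq.
have M1 : associative qmul.
  move=> a b c; rewrite -(repK a) -(repK b) -(repK c) !qmulE; exact/cls_eq.
have M2 : commutative qmul.
  by move=> a b; rewrite -(repK a) -(repK b) !qmulE; exact/cls_eq.
have M3 : left_id (cls one) qmul.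
  by move=> a; rewrite -(repK a) !qmulE; exact/cls_eq.
have M4 : left_distributive qmul qadd.
  move=> a b c; rewrite -(repK a) -(repK b) -(repK c) !(qmulE, qaddE).
  exact/cls_eq.
pose cQ : choiceType := HB.pack_for choiceType Q (gen_eqMixin Q) (gen_choiceMixin Q).
pose zQ : zmodType := HB.pack_for zmodType (cQ : Type) cQ
  (GRing.isZmodule.Build cQ A1 A2 A3 A4).
pose rQ : comPzRingType := HB.pack_for comPzRingType (zQ : Type) zQ
  (GRing.Zmodule_isComPzRing.Build zQ M1 M2 M3 M4).
exists rQ, cls; split.
- by move=> a; exists (rep a); rewrite repK.
- exact: cls_eq.
- by move=> x y; rewrite -qaddE.
- by move=> x y; rewrite -qmulE.
- by split=> // x; rewrite -qoppE.
Qed.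

End Quotient.

(** * Noetherian rings and polynomial rings *)

Definition lincomb (S : comPzRingType) (m : nat) (u c : nat -> S) : S :=
  \sum_(i < m) c i * u i.

(** Equivalent to finite generation of all ideals; in this form the basis theorem and the Artin-Rees
    lemma apply it to a single sequence. *)
Definition noetherian (S : comPzRingType) : Prop :=
  forall u : nat -> S, exists m c, u m = lincomb m u c.

(** Dependent choice in which each term is constrained by all the earlier ones. *)
Lemma sequence_of_prefixes (T : Type) (P : seq T -> T -> Prop) :
  (forall s, exists x, P s x) -> exists u, forall n, P (mkseq u n) (u n).
Proof.
move=> /choice[G PG].
pose fix l n := if n is n'.+1 then rcons (l n') (G (l n')) else [::].
exists (fun n => G (l n)) => n.
suff -> : mkseq (fun n => G (l n)) n = l n by exact: PG.
by elim: n => //= n IHn; rewrite mkseqS IHn.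
Qed.

Lemma lincomb_nth (S : comPzRingType) (x0 : S) (u c : nat -> S) m :
  lincomb m (nth x0 (mkseq u m)) c = lincomb m u c.
Proof. by apply: eq_bigr => i _; rewrite nth_mkseq. Qed.

Lemma noetherian_fg (S : comPzRingType) (J : set S) :
  noetherian S -> is_ideal J -> exists m u,
    (forall i, (i < m)%N -> J (u i)) /\ forall x, J x -> exists c, x = lincomb m u c.
Proof.
move=> nS [J0 JD JM]; apply: contrapT => nfg.
(* The requirement is vacuous for a list that leaves [J], so that every list has an admissible next
   term. *)
have [|u uP] := @sequence_of_prefixes S (fun s x =>
    (forall y, y \in s -> J y) -> J x /\ forall c, x <> lincomb (size s) (nth 0 s) c).
  move=> s; have [sJ|/existsNP[y ny]] := pselect (forall y, y \in s -> J y); last first.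
    by exists 0 => h; case: ny; exact: h.
  apply: contrapT => /forallNP h; apply: nfg; exists (size s), (nth 0 s); split.
    by move=> i lti; apply/sJ/mem_nth.
  move=> x Jx; apply: contrapT => /forallNP nx; exact: (h x).
have uJ n : J (u n).
  elim/ltn_ind: n => n IHn; apply: (uP n _).1 => y /mapP[i].
  by rewrite mem_iota => /andP[_ lti] ->; exact: IHn.
have [m [c um]] := nS u.
have [|_ /(_ c)] := uP m.
  by move=> y /mapP[i _ ->].
by rewrite size_mkseq lincomb_nth.
Qed.

Lemma ideal_sum (S : comPzRingType) (J : set S) m (F : 'I_m -> S) :
  is_ideal J -> (forall i, J (F i)) -> J (\sum_(i < m) F i).
Proof. by case=> J0 JD _ JF; elim/big_ind: _. Qed.

Lemma ideal_opp (S : comPzRingType) (J : set S) x : is_ideal J -> J x -> J (- x).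
Proof. by case=> _ _ JM Jx; rewrite -mulN1r; exact: JM. Qed.

Lemma ideal_lincomb (S : comPzRingType) (J : set S) m u c :
  is_ideal J -> (forall i, (i < m)%N -> J (u i)) -> J (lincomb m u c).
Proof.
by move=> hJ uJ; apply: ideal_sum => // i; case: hJ => _ _; apply; exact: uJ.
Qed.

Lemma lincomb_ideal (S : comPzRingType) (u : nat -> S) m :
  is_ideal [set x | exists c, x = lincomb m u c].
Proof.
split=> [|x y [c ->] [d ->]|a x [c ->]].
- by exists (fun=> 0); rewrite /lincomb big1 // => i _; rewrite mul0r.
- exists (fun i => c i + d i); rewrite /lincomb -big_split /=.
  by apply: eq_bigr => i _; rewrite mulrDl.
- exists (fun i => a * c i); rewrite /lincomb mulr_sumr.
  by apply: eq_bigr => i _; rewrite mulrA.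
Qed.

Lemma lincomb_mem (S : comPzRingType) (u : nat -> S) m i :
  (i < m)%N -> exists c, u i = lincomb m u c.
Proof.
move=> lti; exists (fun j => (j == i)%:R); rewrite /lincomb (bigD1 (Ordinal lti))//=.
by rewrite eqxx mul1r big1 ?addr0// => j /negPf; rewrite -val_eqE /= => ->; rewrite mul0r.
Qed.

Lemma lincomb_widen (S : comPzRingType) (u : nat -> S) m M :
  (m <= M)%N -> forall c, exists d, lincomb m u c = lincomb M u d.
Proof.
move=> le c; apply: (ideal_lincomb _ (lincomb_ideal u M)) => i lti.
exact/lincomb_mem/(leq_trans lti).
Qed.

Lemma fg_noetherian (S : comPzRingType) :
  (forall J : set S, is_ideal J -> exists m u,
    (forall i, (i < m)%N -> J (u i)) /\ forall x, J x -> exists c, x = lincomb m u c) ->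
  noetherian S.
Proof.
move=> fg u; pose J x := exists m c, x = lincomb m u c.
have [|m [v [vJ Jv]]] := fg J.
  split.
  - by exists 0%N, (fun=> 0); rewrite /lincomb big_ord0.
  - move=> x y [m [c ->]] [m' [c' ->]]; exists (maxn m m').
    have [_ + _] := lincomb_ideal u (maxn m m'); apply.
      exact/lincomb_widen/leq_maxl.
    exact/lincomb_widen/leq_maxr.
  - move=> a x [m [c ->]]; exists m; have [_ _ +] := lincomb_ideal u m; apply.
    by exists c.
have [M hM] : exists M, forall i, (i < m)%N -> exists c, v i = lincomb M u c.
  elim: m {Jv} vJ => [|m IHm] vJ; first by exists 0%N.
  have [M hM] := IHm (fun i h => vJ i (ltnW h)).
  have [M' [c' vm]] := vJ m (ltnSn m); exists (maxn M M') => i.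
  rewrite ltnS leq_eqVlt => /orP[/eqP->|/hM[c ->]].
    by rewrite vm; apply/lincomb_widen/leq_maxr.
  by apply/lincomb_widen/leq_maxl.
exists M; have [c ->] : exists c, u M = lincomb m v c.
  by apply: Jv; exists M.+1; exact: lincomb_mem.
exact: (ideal_lincomb _ (lincomb_ideal u M)).
Qed.

(** Hilbert's basis theorem. Each [u n] has least degree among the elements of [J] outside the span
    of its predecessors; a relation between leading coefficients would produce such an element of
    smaller degree. *)
Lemma noetherian_poly (S : comNzRingType) : noetherian S -> noetherian {poly S}.
Proof.
move=> nS; apply: fg_noetherian => J hJ; apply: contrapT => nfg.
have [J0 JD JM] := hJ.
pose good m (v : nat -> {poly S}) x := J x /\ forall c, x <> lincomb m v c.
have [|u uP] := @sequence_of_prefixes {poly S} (fun s x =>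
    (forall y, y \in s -> J y) -> good (size s) (nth 0 s) x /\
    forall y, good (size s) (nth 0 s) y -> (size x <= size y)%N).
  move=> s; have [sJ|/existsNP[y ny]] := pselect (forall y, y \in s -> J y); last first.
    by exists 0 => h; case: ny; exact: h.
  have ex : exists n, `[< exists2 x, good (size s) (nth 0 s) x & size x = n >].
    apply: contrapT => nex; apply: nfg; exists (size s), (nth 0 s); split.
      by move=> i lti; apply/sJ/mem_nth.
    move=> x Jx; apply: contrapT => /forallNP nx; apply: nex.
    by exists (size x); apply/asboolP; exists x.
  case: (ex_minnP ex) => n /asboolP[x gx sx] min; exists x => _; split=> // y gy.
  by rewrite sx; apply: min; apply/asboolP; exists y.
have uJ n : J (u n).
  elim/ltn_ind: n => n IHn; apply: (uP n _).1.1 => y /mapP[i].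
  by rewrite mem_iota => /andP[_ lti] ->; exact: IHn.
have {}uP n : good n u (u n) /\ forall y, good n u y -> (size (u n) <= size y)%N.
  have [|[_ h1] h2] := uP n; first by move=> y /mapP[i _ ->].
  rewrite size_mkseq in h1 h2.
  split; first by split=> // c; rewrite -(lincomb_nth 0); exact: h1.
  by move=> y [Jy hy]; apply: h2; split=> // c; rewrite lincomb_nth.
have le_size i n : (i <= n)%N -> (size (u i) <= size (u n))%N.
  move=> lein; apply: (uP i).2; split=> // c e.
  have [_ h] := (uP n).1; have [d hd] := lincomb_widen u lein c.
  by apply: (h d); rewrite e.
have [m [c lc]] := nS (fun i => lead_coef (u i)).
(* Sizes do not decrease along [u], so the truncated subtraction is exact and [w] has the leading
   term of [u m]. *)
pose w := lincomb m u (fun i => c i *: 'X^(size (u m) - size (u i))).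
have w_span : exists d, w = lincomb m u d by eexists; reflexivity.
have u_gt0 i : (0 < size (u i))%N.
  rewrite size_poly_gt0; apply/eqP => u0; have [_ h] := (uP i).1; apply: (h (fun=> 0)).
  by rewrite u0 /lincomb big1 // => j _; rewrite mul0r.
have : good m u (u m - w).
  split.
    by apply: JD => //; apply: (ideal_opp hJ); apply: ideal_lincomb hJ _ => i _; exact: uJ.
  move=> d e; have [_ h] := (uP m).1.
  have [d'] : exists d', u m = lincomb m u d'; last by move/h.
  have [_ + _] := lincomb_ideal u m => /(_ (u m - w) w); rewrite subrK; apply=> //.
  by exists d.
move/(uP m).2; apply/negP; rewrite -ltnNge.
have ar1 (s t j : nat) : (0 < s -> t.-1 <= j -> t - s <= j)%N by lia.
have ar2 (s t j : nat) : (0 < s -> s <= t -> t.-1 < j -> s <= j - (t - s))%N by lia.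
have ar3 (s t : nat) : (0 < s -> s <= t -> t.-1 - (t - s) = s.-1)%N by lia.
rewrite -(ltn_predK (u_gt0 m)) ltnS; apply/leq_sizeP => j lej.
rewrite coefB /w /lincomb coef_sum.
under eq_bigr => i _.
  rewrite -scalerAl coefZ coefXnM.
  have -> : (j < size (u m) - size (u i))%N = false.
    apply/negbTE; rewrite -leqNgt; exact: (ar1 _ _ _ (u_gt0 i) lej).
  over.
move: lej; rewrite leq_eqVlt => /orP[/eqP<-|ltj]; last first.
  rewrite nth_default ?big1 ?subrr//; last by rewrite -(ltn_predK (u_gt0 m)).
  move=> i _; rewrite nth_default ?mulr0//.
  exact: (ar2 _ _ _ (u_gt0 i) (le_size i m (ltnW (ltn_ord i))) ltj).
apply/eqP; rewrite subr_eq0; apply/eqP; rewrite -lead_coefE lc.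
apply: eq_bigr => i _; congr (_ * _); rewrite lead_coefE; congr (_`_ _).
exact: (esym (ar3 _ _ (u_gt0 i) (le_size i m (ltnW (ltn_ord i))))).
Qed.

Section PolyExtension.
Context (P : comNzRingType) (A : comPzRingType) (f : {rmorphism P -> A}) (y : A).

Let e (p : {poly P}) : A := \sum_(i < size p) f p`_i * y ^+ i.

Let eE N (p : {poly P}) : (size p <= N)%N -> e p = \sum_(i < N) f p`_i * y ^+ i.
Proof.
move=> le; rewrite /e (big_ord_widen _ (fun i => f p`_i * y ^+ i) le).
rewrite big_mkcond; apply: eq_bigr => i _; case: ltnP => // lei.
by rewrite nth_default // rmorph0 mul0r.
Qed.

Let eD : {morph e : p q / p + q}.
Proof.
move=> p q; pose N := maxn (size p) (size q).
rewrite !(@eE N) ?leq_maxl ?leq_maxr ?size_polyD// -big_split /=.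
by apply: eq_bigr => i _; rewrite coefD rmorphD mulrDl.
Qed.

Let eC c : e c%:P = f c.
Proof.
by rewrite (@eE 1) ?size_polyC_leq1// big_ord1 coefC expr0 mulr1.
Qed.

Let eMX p : e (p * 'X) = e p * y.
Proof.
rewrite (@eE (size p).+1); last first.
  by apply: leq_trans (size_polyMleq _ _) _; rewrite size_polyX addn2.
rewrite big_ord_recl coefMX rmorph0 mul0r add0r /e mulr_suml.
by apply: eq_bigr => i _; rewrite coefMX exprSr mulrA.
Qed.

Let eCM c p : e (c%:P * p) = f c * e p.
Proof.
rewrite (@eE (size p)); last by rewrite mul_polyC size_scale_leq.
by rewrite /e mulr_sumr; apply: eq_bigr => i _; rewrite coefCM rmorphM mulrA.
Qed.

Let eM : {morph e : p q / p * q}.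
Proof.
move=> p q; elim/poly_ind: p => [|p c IHp]; first by rewrite mul0r -polyC0 eC rmorph0 mul0r.
by rewrite mulrDl !eD eCM eMX mulrAC eMX IHp eC mulrDl mulrAC.
Qed.

Lemma poly_extension : exists g : {rmorphism {poly P} -> A},
  (forall c, g c%:P = f c) /\ g 'X = y.
Proof.
exists (mk_rmorphism eD eM (etrans (eC 1) (rmorph1 f))); split; first exact: eC.
by rewrite mk_rmorphismE -[X in e X]mul1r eMX eC rmorph1 mul1r.
Qed.
End PolyExtension.

(** The first clause is the part of flatness over [S] that concerns torsion. Uniqueness of the
    evaluation maps follows from the second clause. *)
Definition polynomial_ring (S P : comNzRingType) (i : {rmorphism S -> P}) n
    (X : 'I_n -> P) : Prop :=
  [/\ forall s, (forall x, s * x = 0 -> x = 0) -> forall x, i s * x = 0 -> x = 0,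
      forall E : set P, (forall s, E (i s)) -> (forall j, E (X j)) ->
        (forall x y, E x -> E y -> E (x + y)) ->
        (forall x y, E x -> E y -> E (x * y)) -> forall x, E x
    & forall (A : comPzRingType) (f : {rmorphism S -> A}) (y : 'I_n -> A),
        exists g : {rmorphism P -> A},
          (forall s, g (i s) = f s) /\ forall j, g (X j) = y j].

Lemma polynomial_ring_exists (S : comNzRingType) n : noetherian S ->
  exists (P : comNzRingType) (i : {rmorphism S -> P}) (X : 'I_n -> P),
    noetherian P /\ polynomial_ring i X.
Proof.
move=> nS; elim: n => [|n [P [i [X [nP [P1 P2 P3]]]]]].
  exists S, idfun, (fun=> 0); split=> //; split=> // A f y; exists f; split=> //.
  by case.
pose X' (j : 'I_n.+1) : {poly P} :=
  if unlift ord0 j is Some j' then (X j')%:P else 'X.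
exists {poly P}, (polyC \o i), X'; split; first exact: noetherian_poly.
split.
- move=> s hs x /= /polyP h; apply/polyP => j; rewrite coef0.
  by apply: (P1 s hs); have := h j; rewrite coefCM coef0.
- move=> E ES EX ED EM.
  have EC c : E c%:P.
    apply: (P2 [set c | E c%:P]) => [//|j|x y|x y] /=.
    + by have := EX (lift ord0 j); rewrite /X' liftK.
    + by rewrite polyCD; exact: ED.
    + by rewrite polyCM; exact: EM.
  elim/poly_ind => [|p c Ep]; first by rewrite -polyC0.
  apply: ED => //; apply: EM => //.
  by have := EX ord0; rewrite /X' unlift_none.
- move=> A f y; have [g [gi gX]] := P3 A f (y \o lift ord0).
  have [g' [g'C g'X]] := poly_extension g (y ord0).
  exists g'; split=> [s|j] /=; first by rewrite g'C gi.
  rewrite /X'; case: unliftP => [j' ->|->]; last by rewrite g'X.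
  by rewrite g'C gX.
Qed.

(** * Smooth algebras are torsion-free *)

Section IdealPowers.
Context (P : comNzRingType) (r : nat) (f : nat -> P).

Fixpoint ideal_power (k : nat) : set P :=
  if k is k'.+1 then
    [set x | exists y, (forall i, ideal_power k' (y i)) /\ x = lincomb r f y]
  else setT.

Lemma ideal_power_ideal k : is_ideal (ideal_power k).
Proof.
elim: k => [|k [I0 ID IM]] //=; split.
- exists (fun=> 0); split=> //; rewrite /lincomb big1 // => i _; exact: mul0r.
- move=> x y [a [Ia ->]] [b [Ib ->]]; exists (fun i => a i + b i).
  split=> [i|]; first exact: ID.
  by rewrite /lincomb -big_split; apply: eq_bigr => i _; rewrite mulrDl.
- move=> a x [b [Ib ->]]; exists (fun i => a * b i); split=> [i|]; first exact: IM.
  by rewrite /lincomb mulr_sumr; apply: eq_bigr => i _; rewrite mulrA.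
Qed.

Lemma ideal_power1 : ideal_power 1 = [set x | exists c, x = lincomb r f c].
Proof.
apply/seteqP; split=> x /=; first by move=> [c [_ ->]]; exists c.
by move=> [c ->]; exists c.
Qed.

Lemma ideal_powerM j k x y :
  ideal_power j x -> ideal_power k y -> ideal_power (j + k) (x * y).
Proof.
elim: j x => [|j IHj] x /=.
  by move=> _ Iy; have [_ _] := ideal_power_ideal k; apply.
move=> [a [Ia ->]] Iy; exists (fun i => a i * y); split=> [i|]; first exact: IHj.
by rewrite /lincomb mulr_suml; apply: eq_bigr => i _; rewrite mulrAC.
Qed.

Lemma ideal_power_le j k x : (j <= k)%N -> ideal_power k x -> ideal_power j x.
Proof.
move=> /subnK <-; elim: (k - j)%N x => // {}k IHk x; rewrite addSn => -[a [Ia ->]].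
apply: ideal_sum (ideal_power_ideal j) _ => i; rewrite mulrC.
by have [_ _] := ideal_power_ideal j; apply; exact/IHk/Ia.
Qed.

(* The Rees algebra is a quotient of a polynomial ring over [P], hence
   noetherian; apply this to the sequence [w * x m * t ^ m] of homogeneous
   elements of a family of counterexamples. *)
Lemma artin_rees (w : P) : noetherian P -> (forall x, w * x = 0 -> x = 0) ->
  exists m, forall x, ideal_power m (w * x) -> ideal_power 1 x.
Proof.
move=> nP w_reg; apply: contrapT => /forallNP no.
have /choice[x xP] : forall m, exists x, ideal_power m (w * x) /\ ~ ideal_power 1 x.
  by move=> m; have /existsNP[x /not_implyP] := no m; exists x.
have [Q [i [T [nQ [_ Qind Qext]]]]] := polynomial_ring_exists r nP.
(* [ev] sends T_j to f_j X; its image is the Rees algebra, the sum of the I^k X^k. *)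
have [ev [evi evT]] := Qext _ (polyC : {rmorphism P -> {poly P}}) (fun j => f j *: 'X).
have ev_coef q k : ideal_power k (ev q)`_k.
  have pI := ideal_power_ideal.
  move: q k; apply: (Qind [set q | forall k, ideal_power k (ev q)`_k]) => /=.
  - by move=> c [//|k]; rewrite evi coefC /=; have [] := pI k.+1.
  - move=> j k; rewrite evT coefZ coefX.
    case: (k =P 1%N) => [->|_]; last by rewrite mulr0; have [] := pI k.
    by rewrite mulr1 ideal_power1; exact: lincomb_mem.
  - by move=> a b Ia Ib k; rewrite rmorphD coefD; have [_ + _] := pI k; apply.
  - move=> a b Ia Ib k; rewrite rmorphM coefM; apply: ideal_sum => // j.
    by rewrite -[k in ideal_power k](subnKC (ltnSE (ltn_ord j))); exact: ideal_powerM.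
have ev_onto k y : ideal_power k y -> exists q, ev q = y *: 'X^k.
  elim: k y => [|k IHk] y /=.
    by move=> _; exists (i y); rewrite evi expr0 alg_polyC.
  move=> [a [Ia ->]]; have /choice[q qP] : forall j, exists q, ev q = a j *: 'X^k.
    by move=> j; exact: IHk.
  exists (\sum_(j < r) q j * T j); rewrite rmorph_sum /= scaler_suml; apply: eq_bigr => j _.
  by rewrite rmorphM evT qP -scalerAl -scalerAr scalerA exprSr.
have /choice[q qP] : forall m, exists q, ev q = (w * x m) *: 'X^m.
  by move=> m; apply: ev_onto; have [] := xP m.
have [m [c qm]] := nQ q; have [_] := xP m; apply.
(* In degree m the relation expresses w x_m through the w x_j with j < m, and w cancels. The
   coefficients have degree m - j > 0, hence lie in I. *)
suff -> : x m = \sum_(j < m) (ev (c j))`_(m - j) * x j.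
  apply: ideal_sum (ideal_power_ideal 1) _ => j; rewrite mulrC.
  have [_ _] := ideal_power_ideal 1; apply; apply: ideal_power_le (ev_coef _ _).
  by rewrite subn_gt0.
apply/eqP; rewrite -subr_eq0; apply/eqP/w_reg; rewrite mulrBr; apply/eqP.
rewrite subr_eq0; apply/eqP; have := congr1 (fun q => (ev q)`_m) qm.
rewrite qP coefZ coefXn eqxx mulr1 => ->.
rewrite rmorph_sum coef_sum mulr_sumr; apply: eq_bigr => j _.
rewrite rmorphM qP -scalerAr coefZ coefMXn ltnNge ltnW //=; ring.
Qed.

End IdealPowers.

Lemma ideal_quotient (P : comPzRingType) (J : set P) : is_ideal J ->
  exists (D : comPzRingType) (c : {rmorphism P -> D}),
    (forall d, exists x, d = c x) /\ forall x, c x = 0 <-> J x.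
Proof.
move=> hJ; have [J0 JD JM] := hJ.
have [||||||||||||||D [c [cS cE cD cM [c1 _]]]] := @quotient_ring P
  (fun x y => J (x - y)) +%R *%R -%R 0 1.
- by move=> x; rewrite subrr.
- by move=> x y /(ideal_opp hJ); rewrite opprB.
- by move=> x y z h1 h2; rewrite -[x](subrK y) -addrA; exact: JD.
- by move=> x x' y; rewrite opprD addrACA subrr addr0.
- by move=> x x' y; rewrite -mulrBl mulrC; exact: JM.
- by move=> x x' /(ideal_opp hJ); rewrite opprD.
- by move=> x y z; rewrite [x + (y + z)]addrA subrr.
- by move=> x y; rewrite [x + y]addrC subrr.
- by move=> x; rewrite add0r subrr.
- by move=> x; rewrite addNr subrr.
- by move=> x y z; rewrite mulrA subrr.
- by move=> x y; rewrite [x * y]mulrC subrr.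
- by move=> x; rewrite mul1r subrr.
- by move=> x y z; rewrite mulrDl subrr.
pose g := mk_rmorphism cD cM c1; exists D, g; split=> // x.
by rewrite -(rmorph0 g) (cE x 0) subr0.
Qed.

Lemma rmorphism_factor (P D B : comPzRingType) (c : {rmorphism P -> D})
    (g : {rmorphism P -> B}) :
  (forall d, exists x, d = c x) -> (forall x, c x = 0 -> g x = 0) ->
  exists h : {rmorphism D -> B}, forall x, h (c x) = g x.
Proof.
move=> /choice[s sK] ker.
have gE x y : c x = c y -> g x = g y.
  move=> e; apply/eqP; rewrite -subr_eq0 -rmorphB; apply/eqP/ker.
  by rewrite rmorphB e subrr.
have hD : {morph g \o s : x y / x + y}.
  by move=> x y /=; rewrite -rmorphD; apply: gE; rewrite rmorphD -!sK.
have hM : {morph g \o s : x y / x * y}.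
  by move=> x y /=; rewrite -rmorphM; apply: gE; rewrite rmorphM -!sK.
have h1 : (g \o s) 1 = 1.
  by rewrite -(rmorph1 g); apply: gE; rewrite rmorph1 -sK.
by exists (mk_rmorphism hD hM h1) => x /=; apply: gE; rewrite -sK.
Qed.

Definition torsion_free (S : comPzRingType) (A : Alg S) : Prop :=
  forall s x, s != 0 -> str A s * x = 0 -> x = 0.

(* Write [B = P/I] with [P] a polynomial ring. Lifting the identity of [B] to
   [P/I^2] gives an endomorphism [sigma] of [P] that is the identity modulo
   [I] and maps [I] into [I^2]. If [w x] is in [I] then
   [w sigma^m(x) = sigma^m(w x)] is in [I^(m+1)], so that [sigma^m(x)], hence
   [x], is in [I] by the Artin-Rees lemma. *)
Lemma smooth_torsion_free (S : idomainType) (B : Alg S) n (tau : 'I_n -> B) :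
  noetherian S -> generates tau -> smooth B -> torsion_free B.
Proof.
move=> nS gen [_ lift].
have [P [i [X [nP [i_reg Pind Pext]]]]] := polynomial_ring_exists n nS.
have [ev [evi evX]] := Pext _ (str B) tau.
have ev_onto b : exists x, b = ev x.
  have [l ->] := gen b; exists (\sum_(t <- l) i t.1 * \prod_(j < n) X j ^+ t.2 j).
  rewrite rmorph_sum; apply: eq_bigr => t _; rewrite rmorphM rmorph_prod evi.
  by congr (_ * _); apply: eq_bigr => j _; rewrite rmorphXn evX.
have kerI : is_ideal [set x | ev x = 0].
  split=> [|x y /= hx hy|a x /= hx].
  - exact: rmorph0.
  - by rewrite rmorphD hx hy addr0.
  - by rewrite rmorphM hx mulr0.
have [r [f [fI If]]] := noetherian_fg nP kerI.
have power1 x : ideal_power r f 1 x <-> ev x = 0.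
  rewrite ideal_power1; split=> [[c ->]|/If//]; exact: ideal_lincomb kerI fI.
have [D [c [c_onto c0]]] := ideal_quotient (ideal_power_ideal r f 2).
have [|q qc] := rmorphism_factor (g := ev) c_onto.
  by move=> x /c0 /(@ideal_power_le _ _ _ 1 2 _ isT) /power1.
pose DA : Alg S := mkAlg (c \o i).
have q_str s : q (str DA s) = str B s by rewrite /= qc evi.
pose qA : algHom DA B := AlgHom q_str.
pose idB : algHom B B := @AlgHom _ B B idfun (fun=> erefl).
have [|s sP] := lift DA B qA idB.
  split=> [b|x y].
    by have [x ->] := ev_onto b; exists (c x); rewrite /= qc.
  have [x' ->] := c_onto x; have [y' ->] := c_onto y; rewrite /= !qc.
  move=> /power1 hx /power1 hy; rewrite -rmorphM; apply/c0.
  exact: (ideal_powerM hx hy).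
have /choice[y yP] : forall j, exists y, s (tau j) = c y by move=> j; exact: c_onto.
have [sg [sgi sgX]] := Pext P i y.
have c_sg x : c (sg x) = s (ev x).
  apply: (Pind [set x | c (sg x) = s (ev x)]) => /=.
  - by move=> a; rewrite sgi evi; have := alghom_str s a => /= ->.
  - by move=> j; rewrite sgX evX.
  - by move=> a b ha hb; rewrite !rmorphD /= ha hb.
  - by move=> a b ha hb; rewrite !rmorphM /= ha hb.
have ev_sg x : ev (sg x) = ev x.
  rewrite -qc c_sg; have := congr1 (fun g : algHom B B => g (ev x)) sP; exact.
(* In a product a_j f_j the factor a_j gains one power by induction, while f_j merely stays in I. *)
have sg_power k x : ideal_power r f k.+1 x -> ideal_power r f k.+2 (sg x).
  elim: k x => [|k IHk] x.
    by move=> /power1 hx; apply/c0; rewrite c_sg hx rmorph0.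
  move=> [a [Ia ->]]; rewrite rmorph_sum; apply: ideal_sum => [|j].
    exact: ideal_power_ideal.
  rewrite rmorphM mulrC; apply: (ideal_powerM (j := 1) (k := k.+2)); last exact/IHk/Ia.
  by apply/power1; rewrite ev_sg; exact: fI.
move=> w b w0; have [x ->] := ev_onto b; rewrite -evi -rmorphM => /power1 wx.
have iw_reg : forall x, i w * x = 0 -> x = 0.
  apply: i_reg => z /eqP; rewrite mulf_eq0 (negPf w0) => /eqP; exact.
have [m mP] := artin_rees r f nP iw_reg.
have iter_power k : ideal_power r f k.+1 (iter k sg (i w * x)).
  by elim: k => //= k IHk; exact: sg_power.
have iter_mul k : iter k sg (i w * x) = i w * iter k sg x.
  by elim: k => //= k ->; rewrite rmorphM sgi.
have : ideal_power r f 1 (iter m sg x).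
  by apply/mP; rewrite -iter_mul; exact: ideal_power_le (iter_power m).
move=> /power1; suff -> : ev (iter m sg x) = ev x by [].
by elim: (m) => //= k IHk; rewrite ev_sg.
Qed.

(** * Torsion-free modules over a valuation ring *)

Definition valuation_ring (S : comPzRingType) : Prop :=
  forall x y : S, (exists z, y = x * z) \/ (exists z, x = y * z).

Section Span.
Context (S : comPzRingType) (C : Alg S).

Definition combo m (a : 'I_m -> S) (e : 'I_m -> C) : C :=
  \sum_(l < m) str C (a l) * e l.

Definition span m (e : 'I_m -> C) : set C := [set x | exists a, x = combo a e].

Definition lin_indep m (e : 'I_m -> C) : Prop :=
  forall a, combo a e = 0 -> forall l, a l = 0.

Lemma comboD m (a b : 'I_m -> S) e :
  combo (fun l => a l + b l) e = combo a e + combo b e.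
Proof.
by rewrite /combo -big_split; apply: eq_bigr => l _; rewrite rmorphD mulrDl.
Qed.

Lemma comboZ m s (a : 'I_m -> S) e :
  combo (fun l => s * a l) e = str C s * combo a e.
Proof.
by rewrite /combo mulr_sumr; apply: eq_bigr => l _; rewrite rmorphM mulrA.
Qed.

Lemma span0 m (e : 'I_m -> C) : span e 0.
Proof. by exists (fun=> 0); rewrite /combo big1 // => l _; rewrite rmorph0 mul0r. Qed.

Lemma spanD m (e : 'I_m -> C) x y : span e x -> span e y -> span e (x + y).
Proof. by move=> [a ->] [b ->]; eexists; rewrite -comboD. Qed.

Lemma spanZ m (e : 'I_m -> C) s x : span e x -> span e (str C s * x).
Proof. by move=> [a ->]; eexists; rewrite -comboZ. Qed.

Lemma span_combo m (e : 'I_m -> C) k (a : 'I_k -> S) (f : 'I_k -> C) :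
  (forall j, span e (f j)) -> span e (combo a f).
Proof.
move=> h; rewrite /combo; elim/big_ind: _ => [|x y|j _]; first exact: span0.
- exact: spanD.
- exact: spanZ.
Qed.

Lemma span_mem m (e : 'I_m -> C) l : span e (e l).
Proof.
exists (fun j => (j == l)%:R); rewrite /combo (bigD1 l)//= eqxx rmorph1 mul1r.
by rewrite big1 ?addr0// => j /negPf ->; rewrite rmorph0 mul0r.
Qed.

Lemma span_trans m k (e : 'I_m -> C) (f : 'I_k -> C) :
  (forall j, span e (f j)) -> span f `<=` span e.
Proof. by move=> h x [a ->]; exact: span_combo. Qed.

End Span.

Lemma least_divisor (S : idomainType) m (a : 'I_m -> S) :
  valuation_ring S -> (exists l, a l != 0) ->
  exists l0, a l0 != 0 /\ forall l, exists z, a l = a l0 * z.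
Proof.
move=> vS [l al].
have [x xs xP] : exists2 x, x \in codom a & forall y, y \in codom a -> exists z, y = x * z.
  have : codom a != [::] by rewrite -size_eq0 size_codom card_ord; case: m a l al => // ? [].
  elim: (codom a) => // x [_ _|y s /(_ isT)[z zs zP] _].
    exists x; rewrite ?mem_head// => y; rewrite inE => /eqP ->.
    by exists 1; rewrite mulr1.
  have [[t zt]|[t xt]] := vS x z.
    exists x; rewrite ?mem_head// => w; rewrite inE => /orP[/eqP->|/zP[w' ->]].
      by exists 1; rewrite mulr1.
    by exists (t * w'); rewrite zt mulrA.
  exists z; first by rewrite inE zs orbT.
  by move=> w; rewrite inE => /orP[/eqP->|/zP//]; exists t.
have [l0 x0] := codomP xs; exists l0; rewrite -x0.
have div j : exists z, a j = x * z by apply/xP/codom_f.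
split=> //; apply: contraNneq al => x00; have [z ->] := div l.
by rewrite x00 mul0r.
Qed.

Section Bases.
Context (S : idomainType) (C : Alg S).
Hypotheses (vS : valuation_ring S) (tfC : torsion_free C).

(** A relation can be divided by a coefficient that divides all the others, because [C] is
    torsion-free; the coefficient 1 that remains makes one generator redundant. *)
Lemma span_basis m (f : 'I_m -> C) :
  exists k (e : 'I_k -> C), lin_indep e /\ span e = span f.
Proof.
elim: m f => [|m IHm] f; first by exists 0%N, f; split=> // a _ [].
have [fi|] := pselect (lin_indep f); first by exists m.+1, f.
move=> /existsNP[a /not_implyP[rel /existsNP[l /eqP al]]].
have [l0 [al0 /choice[z az]]] := least_divisor vS (ex_intro _ l al).
have zrel : combo z f = 0.
  apply: (tfC al0); rewrite -comboZ -rel; congr combo.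
  by apply/funext => j; rewrite -az.
have zl0 : z l0 = 1 by apply: (mulfI al0); rewrite -az mulr1.
have [k [e [ei eE]]] := IHm (f \o lift l0).
exists k, e; split=> //; rewrite {}eE.
apply/seteqP; split; apply: span_trans => j; first exact: span_mem.
case: (unliftP l0 j) => [j' ->|->]; first exact: (span_mem (f \o lift l0)).
have /eqP := zrel; rewrite /combo (bigD1_ord l0) //= zl0 rmorph1 mul1r addr_eq0.
move=> /eqP ->; rewrite -mulN1r -(rmorph1 (str C)) -rmorphN; apply: spanZ.
by exists (z \o lift l0).
Qed.

Lemma finite_basis (s : seq C) :
  exists k (e : 'I_k -> C), lin_indep e /\ forall x, x \in s -> span e x.
Proof.
have [k [e [ei eE]]] := span_basis (tnth (in_tuple s)).
exists k, e; split=> // x xs; rewrite eE.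
by have /tnthP[j ->] : x \in in_tuple s by []; exact: span_mem.
Qed.

(** Induction on [m], as for modules over any noetherian ring. [f] may be dependent, so [J] collects
    the first coefficients of all expressions of elements of [V]. *)
Lemma submodule_fg (nS : noetherian S) m (f : 'I_m -> C) (V : set C) :
  V 0 -> (forall x y, V x -> V y -> V (x + y)) ->
  (forall s x, V x -> V (str C s * x)) -> V `<=` span f ->
  exists k (v : 'I_k -> C), span v = V.
Proof.
have sub k (v : 'I_k -> C) (U : set C) : U 0 -> (forall x y, U x -> U y -> U (x + y)) ->
    (forall s x, U x -> U (str C s * x)) -> (forall l, U (v l)) -> span v `<=` U.
  by move=> U0 UD UZ Uv x [a ->]; rewrite /combo; elim/big_ind: _ => // l _; exact: UZ.
elim: m f V => [|m IHm] f V V0 VD VZ Vf.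
  exists 0%N, f; apply/seteqP; split; last exact: Vf.
  by apply: sub => // -[].
pose J a0 := exists a, a ord0 = a0 /\ V (combo a f).
have hJ : is_ideal J.
  split.
  - exists (fun=> 0); split=> //; rewrite (_ : combo _ _ = 0) // /combo big1 // => l _.
    by rewrite rmorph0 mul0r.
  - move=> _ _ [a [<- Va]] [b [<- Vb]]; exists (fun l => a l + b l).
    by rewrite comboD; split=> //; exact: VD.
  - move=> s _ [a [<- Va]]; exists (fun l => s * a l).
    by rewrite comboZ; split=> //; exact: VZ.
have [k [u [uJ Ju]]] := noetherian_fg nS hJ.
have /choice[b bP] : forall i : 'I_k, exists b, b ord0 = u i /\ V (combo b f).
  by move=> i; exact: uJ.
pose V' := V `&` span (f \o lift ord0).
have [||||k' [v vE]] := IHm (f \o lift ord0) V'.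
- by split=> //; exact: span0.
- by move=> x y [? ?] [? ?]; split; [exact: VD|exact: spanD].
- by move=> s x [? ?]; split; [exact: VZ|exact: spanZ].
- by move=> x [].
pose w (j : 'I_(k + k')) := match fintype.split j with
  inl i => combo (b i) f | inr i => v i end.
have wl i : w (lshift k' i) = combo (b i) f by rewrite /w (unsplitK (inl _ i)).
have wr i : w (rshift k i) = v i by rewrite /w (unsplitK (inr _ i)).
exists (k + k')%N, w; apply/seteqP; split.
  apply: sub => // j; rewrite /w; case: fintype.split => i; first by have [] := bP i.
  by have [] : V' (v i) by rewrite -vE; exact: span_mem.
move=> x Vx; have [a xa] := Vf _ Vx.
have [c a0] : exists c, a ord0 = lincomb k u c by apply: Ju; exists a; rewrite -xa.
pose y := combo (c \o @nat_of_ord k) (fun i : 'I_k => combo (b i) f).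
have wy : span w y by apply: span_combo => i; rewrite -wl; exact: span_mem.
have Vy : V y by apply: (sub k (fun i : 'I_k => combo (b i) f)) => //; [move=> i; have [] := bP i|eexists].
rewrite -[x](subrK y); apply: spanD wy.
suff : span v (x - y).
  by apply: span_trans => i; rewrite -wr; exact: span_mem.
rewrite vE; split.
  by apply: VD => //; rewrite -mulN1r -(rmorph1 (str C)) -rmorphN; exact: VZ.
exists (fun l => a (lift ord0 l) - \sum_(i < k) c i * b i (lift ord0 l)).
have yE : y = \sum_(l < m.+1) str C (\sum_(i < k) c i * b i l) * f l.
  rewrite /y /combo; under eq_bigr do rewrite mulr_sumr.
  rewrite exchange_big; apply: eq_bigr => l _ /=; rewrite rmorph_sum mulr_suml.
  by apply: eq_bigr => i _; rewrite rmorphM mulrA.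
rewrite yE xa /combo -sumrB big_ord_recl a0 /lincomb.
under [X in _ - str C X * _]eq_bigr => i _ do rewrite (bP i).1.
rewrite subrr add0r; apply: eq_bigr => l _.
by rewrite -mulrBl -rmorphB.
Qed.

End Bases.

(** * Tensor products with a torsion-free algebra *)

Section Tensor.
Context (S : idomainType) (W C : Alg S).
Hypotheses (vS : valuation_ring S) (tfC : torsion_free C).

(** Outside the span of [e] the value 0 is a default; inside, the choice is forced only when [e] is
    independent. *)
Definition coord m (e : 'I_m -> C) (x : C) : 'I_m -> S :=
  if pselect (span e x) is left h then projT1 (cid h) else fun=> 0.

Lemma coordK m (e : 'I_m -> C) x : span e x -> x = combo (coord e x) e.
Proof. by rewrite /coord; case: pselect => // h _; case: cid. Qed.

Lemma coord_unique m (e : 'I_m -> C) a : lin_indep e -> coord e (combo a e) = a.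
Proof.
move=> ei; apply/funext => l; apply/eqP; rewrite -subr_eq0; apply/eqP.
apply: (ei (fun l => coord e (combo a e) l - a l)).
have /coordK h : span e (combo a e) by exists a.
rewrite /combo; under eq_bigr do rewrite rmorphB mulrBl.
by rewrite sumrB -!/(combo _ _) -h subrr.
Qed.

Lemma coordD m (e : 'I_m -> C) x y l : lin_indep e -> span e x -> span e y ->
  coord e (x + y) l = coord e x l + coord e y l.
Proof. by move=> ei [a ->] [b ->]; rewrite -comboD !coord_unique. Qed.

Lemma coordZ m (e : 'I_m -> C) s x l : lin_indep e -> span e x ->
  coord e (str C s * x) l = s * coord e x l.
Proof. by move=> ei [a ->]; rewrite -comboZ !coord_unique. Qed.

Lemma coord_combo m (e : 'I_m -> C) k a (f : 'I_k -> C) l :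
  lin_indep e -> (forall j, span e (f j)) ->
  coord e (combo a f) l = \sum_(j < k) a j * coord e (f j) l.
Proof.
move=> ei ef.
rewrite (_ : combo a f = combo (fun l => \sum_(j < k) a j * coord e (f j) l) e).
  by rewrite coord_unique.
rewrite /combo; under [RHS]eq_bigr do rewrite rmorph_sum mulr_suml.
rewrite exchange_big; apply: eq_bigr => j _ /=.
rewrite {1}(coordK (ef j)) /combo mulr_sumr; apply: eq_bigr => i _.
by rewrite rmorphM mulrA.
Qed.

Let X := seq (W * C).

Let wt m (e : 'I_m -> C) l (p : W * C) : W := str W (coord e p.2 l) * p.1.

Let coords m (e : 'I_m -> C) (s : X) l : W := \sum_(p <- s) wt e l p.

(* A formal sum of pairs stands for the corresponding sum of elementary
   tensors; [C] being the filtered union of its free submodules of finite rank,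
   two sums are equal when they have the same coordinates with respect to all
   large enough independent families. *)
Let same (s t : X) := exists L : seq C, forall m (e : 'I_m -> C),
  lin_indep e -> (forall x, x \in L -> span e x) ->
  forall l, coords e s l = coords e t l.

Let add (s t : X) : X := s ++ t.
Let mul (s t : X) : X := [seq (p.1 * q.1, p.2 * q.2) | p <- s, q <- t].
Let opp (s : X) : X := [seq (- p.1, p.2) | p <- s].

Let coords_cat m (e : 'I_m -> C) s t l :
  coords e (add s t) l = coords e s l + coords e t l.
Proof. by rewrite /coords big_cat. Qed.

Let coords_mul m (e : 'I_m -> C) s t l :
  coords e (mul s t) l =
  \sum_(p <- s) \sum_(q <- t) str W (coord e (p.2 * q.2) l) * (p.1 * q.1).
Proof. by rewrite /coords big_allpairs_dep. Qed.

Let coords_opp m (e : 'I_m -> C) s l : coords e (opp s) l = - coords e s l.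
Proof.
by rewrite /coords big_map -sumrN; apply: eq_bigr => p _; rewrite /wt mulrN.
Qed.

Let coords1 m (e : 'I_m -> C) p l : coords e [:: p] l = wt e l p.
Proof. by rewrite /coords big_seq1. Qed.

Let same_coords s t :
  (forall m (e : 'I_m -> C) l, coords e s l = coords e t l) -> same s t.
Proof. by exists [::]. Qed.

Let same_sym s t : same s t -> same t s.
Proof. by move=> [L h]; exists L => m e ei eL l; rewrite h. Qed.

Let same_trans s t u : same s t -> same t u -> same s u.
Proof.
move=> [L h] [L' h']; exists (L ++ L') => m e ei eL l.
by rewrite h ?h' // => x xL; apply: eL; rewrite mem_cat xL ?orbT.
Qed.

Let same_add s s' t : same s s' -> same (add s t) (add s' t).
Proof. by move=> [L h]; exists L => m e ei eL l; rewrite !coords_cat h. Qed.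

Let same_opp s s' : same s s' -> same (opp s) (opp s').
Proof. by move=> [L h]; exists L => m e ei eL l; rewrite !coords_opp h. Qed.

(** Once the second components of [s] are expanded in [f], the product depends on [s] only through
    its coordinates, which equivalent sums share. *)
Let mul_expand m (e : 'I_m -> C) k (f : 'I_k -> C) (s t : X) l :
  lin_indep e -> (forall p, p \in s -> span f p.2) ->
  (forall j q, q \in t -> span e (f j * q.2)) ->
  coords e (mul s t) l = \sum_(q <- t) \sum_(j < k)
    str W (coord e (f j * q.2) l) * (coords f s j * q.1).
Proof.
move=> ei fs et; rewrite coords_mul exchange_big /= big_seq [RHS]big_seq.
apply: eq_bigr => q qt; rewrite /coords.
under [RHS]eq_bigr do rewrite mulr_suml mulr_sumr.
rewrite exchange_big /= big_seq [RHS]big_seq; apply: eq_bigr => p ps.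
have -> : p.2 * q.2 = combo (coord f p.2) (fun j => f j * q.2).
  rewrite {1}(coordK (fs _ ps)) /combo mulr_suml.
  by apply: eq_bigr => j _; rewrite mulrA.
rewrite coord_combo //; last by move=> j; exact: et.
rewrite rmorph_sum mulr_suml; apply: eq_bigr => j _; rewrite rmorphM /wt; ring.
Qed.

Let same_mul s s' t : same s s' -> same (mul s t) (mul s' t).
Proof.
move=> [L h].
have [k [f [fi fL]]] := finite_basis vS tfC (L ++ [seq p.2 | p <- s ++ s']).
have fss p : p \in s ++ s' -> span f p.2.
  by move=> ps; apply: fL; rewrite mem_cat map_f ?orbT.
(* A family spanning these products is large enough for [mul_expand]. *)
exists [seq f j * q.2 | j <- enum 'I_k, q <- t] => m e ei eL l.
have et j q : q \in t -> span e (f j * q.2).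
  by move=> qt; apply: eL; apply/allpairsP; exists (j, q); rewrite /= mem_enum.
rewrite !(mul_expand l ei _ et); last 2 first.
- by move=> p ps; apply: fss; rewrite mem_cat ps orbT.
- by move=> p ps; apply: fss; rewrite mem_cat ps.
apply: eq_bigr => q _; apply: eq_bigr => j _; congr (_ * (_ * _)).
by apply: h => // x xL; apply: fL; rewrite mem_cat xL.
Qed.

Let mulA s t u : same (mul s (mul t u)) (mul (mul s t) u).
Proof.
apply: same_coords => m e l; rewrite !coords_mul big_allpairs_dep.
apply: eq_bigr => p _; rewrite big_allpairs_dep; apply: eq_bigr => q _.
by apply: eq_bigr => r _ /=; rewrite !mulrA.
Qed.

Let mulC s t : same (mul s t) (mul t s).
Proof.
apply: same_coords => m e l; rewrite !coords_mul exchange_big.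
by apply: eq_bigr => p _; apply: eq_bigr => q _; rewrite mulrC [p.2 * _]mulrC [p.1 * _]mulrC mulrC.
Qed.

Let mulD s t u : same (mul (add s t) u) (add (mul s u) (mul t u)).
Proof.
by apply: same_coords => m e l; rewrite coords_cat !coords_mul big_cat.
Qed.

(** The third clause expresses the flatness of [C]: an equality of two sums can be read off
    coordinate by coordinate in [W]. The last clause lets the product itself serve as the factor [C]
    of another one. *)
Lemma tensor_exists : exists (T : Alg S) (i1 : algHom W T) (i2 : algHom C T),
  [/\ forall t, exists s : seq (W * C), t = \sum_(p <- s) i1 p.1 * i2 p.2,
      forall (A : Alg S) (x : algHom W A) (y : algHom C A),
        exists h : algHom T A, algComp h i1 = x /\ algComp h i2 = y,
      forall s t : seq (W * C),
        \sum_(p <- s) i1 p.1 * i2 p.2 = \sum_(p <- t) i1 p.1 * i2 p.2 ->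
        exists m (e : 'I_m -> C) (a : C -> 'I_m -> S),
          (forall p, p \in s ++ t -> p.2 = combo (a p.2) e) /\
          forall l, \sum_(p <- s) str W (a p.2 l) * p.1 =
                    \sum_(p <- t) str W (a p.2 l) * p.1
    & torsion_free W -> torsion_free T].
Proof.
have [||||||T [c [c_onto cE cD cM [c1 cN]]]] := @quotient_ring X same add mul opp
    [::] [:: (1, 1)] _ same_sym same_trans same_add same_mul same_opp
    _ _ _ _ mulA mulC _ mulD.
- by move=> s; apply: same_coords.
- by move=> s t u; rewrite /add catA; apply: same_coords.
- by move=> s t; apply: same_coords => m e l; rewrite !coords_cat addrC.
- by move=> s; apply: same_coords.
- move=> s; apply: same_coords => m e l.
  by rewrite coords_cat coords_opp addNr /coords big_nil.
- move=> s; apply: same_coords => m e l.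
  by rewrite coords_mul big_seq1 /=; apply: eq_bigr => p _; rewrite !mul1r.
have sameE x y : same x y -> c x = c y by move/cE.
have c0 : c [::] = 0 by apply: (addrI (c [::])); rewrite -cD addr0.
pose j1 w := c [:: (w, 1)]; pose j2 x := c [:: (1, x)].
have j1D : {morph j1 : x y / x + y}.
  move=> x y; rewrite /j1 -cD; apply/sameE/same_coords => m e l.
  by rewrite coords_cat !coords1 /wt mulrDr.
have j1M : {morph j1 : x y / x * y}.
  by move=> x y; rewrite /j1 -cM /mul /= mulr1.
have j2D : {morph j2 : x y / x + y}.
  move=> x y; rewrite /j2 -cD; apply: sameE; exists [:: x; y] => m e ei eL l.
  rewrite coords_cat !coords1 /wt !mulr1 coordD ?rmorphD//; apply: eL.
    by rewrite mem_head.
  by rewrite !inE eqxx orbT.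
have j2M : {morph j2 : x y / x * y}.
  by move=> x y; rewrite /j2 -cM /mul /= mulr1.
pose g1 : {rmorphism W -> T} := mk_rmorphism j1D j1M c1.
pose g2 : {rmorphism C -> T} := mk_rmorphism j2D j2M c1.
pose TA : Alg S := mkAlg (g1 \o str W).
have g2s s : g2 (str C s) = str TA s.
  apply: sameE; exists [:: 1] => m e ei eL l.
  rewrite !coords1 /wt /= -[str C s]mulr1 coordZ //; last exact/eL/mem_head.
  by rewrite mulr1 rmorphM mulrC.
pose i1 : algHom W TA := @AlgHom _ W TA g1 (fun=> erefl).
pose i2 : algHom C TA := @AlgHom _ C TA g2 g2s.
have cS s : c s = \sum_(p <- s) i1 p.1 * i2 p.2.
  elim: s => [|p s IHs]; first by rewrite c0 big_nil.
  rewrite big_cons -IHs (_ : i1 p.1 * i2 p.2 = c [:: p]) -?cD //.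
  rewrite /= /j1 /j2 -cM /mul /= mulr1 mul1r; by case: p.
exists TA, i1, i2; split.
- by move=> t; have [s ->] := c_onto t; exists s.
- move=> A x y.
  pose val (s : X) := \sum_(p <- s) x p.1 * y p.2.
  have val_same s t : same s t -> val s = val t.
    move=> [L h].
    have [k [f [fi fL]]] := finite_basis vS tfC (L ++ [seq p.2 | p <- s ++ t]).
    have expand u : (forall p, p \in u -> span f p.2) ->
        val u = \sum_(j < k) x (coords f u j) * y (f j).
      move=> fu; rewrite /val /coords.
      under [RHS]eq_bigr do rewrite rmorph_sum mulr_suml.
      rewrite exchange_big /= big_seq [RHS]big_seq; apply: eq_bigr => p pu.
      rewrite {1}(coordK (fu _ pu)) rmorph_sum mulr_sumr; apply: eq_bigr => j _.
      rewrite !rmorphM !alghom_str; ring.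
    rewrite !expand; first last.
    + by move=> p ps; apply: fL; rewrite mem_cat map_f ?orbT // mem_cat ps.
    + by move=> p ps; apply: fL; rewrite mem_cat map_f ?orbT // mem_cat ps orbT.
    apply: eq_bigr => j _; rewrite h // => z zL; apply: fL.
    by rewrite mem_cat zL.
  have /choice[r rP] := c_onto.
  have hE s : val (r (c s)) = val s by apply/val_same/cE; rewrite -rP.
  have hD : {morph val \o r : a b / a + b}.
    move=> a b /=; rewrite {1}(rP a) {1}(rP b) -cD hE; exact: big_cat.
  have hM : {morph val \o r : a b / a * b}.
    move=> a b /=; rewrite {1}(rP a) {1}(rP b) -cM hE /val big_allpairs_dep mulr_suml.
    apply: eq_bigr => p _; rewrite mulr_sumr; apply: eq_bigr => q _.
    rewrite /= !rmorphM; ring.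
  have h1 : (val \o r) 1 = 1.
    by rewrite /= -c1 hE /val big_seq1 !rmorph1 mulr1.
  pose h := mk_rmorphism hD hM h1.
  have hi1 w : h (i1 w) = x w.
    by rewrite /= /j1 hE /val big_seq1 rmorph1 mulr1.
  have hi2 w : h (i2 w) = y w.
    by rewrite /= /j2 hE /val big_seq1 rmorph1 mul1r.
  have hs s : h (str TA s) = str A s by rewrite -(alghom_str i1) hi1 alghom_str.
  exists (@AlgHom _ TA A h hs).
  by split; apply: algHom_eq => w; [exact: hi1|exact: hi2].
- move=> s t; rewrite -!cS => /cE[L h].
  have [k [f [fi fL]]] := finite_basis vS tfC (L ++ [seq p.2 | p <- s ++ t]).
  exists k, f, (coord f); split=> [p ps|l].
    by apply/coordK/fL; rewrite mem_cat map_f ?orbT.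
  by apply: h => // x xL; apply: fL; rewrite mem_cat xL.
- move=> tfW o t o0; have [s ->] := c_onto t; rewrite -c0 /= /j1 -cM => /cE[L h].
  apply: sameE; exists L => m e ei eL l; rewrite [RHS]big_nil; apply: (tfW _ _ o0).
  have := h m e ei eL l; rewrite coords_mul big_seq1 /coords big_nil; apply: etrans.
  by rewrite mulr_sumr; apply: eq_bigr => q _; rewrite /= mul1r /wt mulrCA.
Qed.
End Tensor.

(** * Comodules and invariant functions *)

Section PointLemmas.
Context (O : comPzRingType) (G : affineGroup O).

Lemma pt_map1 (A B : Alg O) (f : algHom A B) :
  pt_map f (1%g : points G A) = 1%g.
Proof.
by apply: (mulgI (pt_map f (1%g : points G A))); rewrite -pt_mapM !mulg1.
Qed.

Lemma pt_fun_map (A B : Alg O) (f : algHom A B) (g : points G A) b :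
  pt_fun (pt_map f g) b = f (pt_fun g b).
Proof. by []. Qed.

Definition base_alg : Alg O := mkAlg (idfun : {rmorphism O -> O}).

Definition base_hom (A : Alg O) : algHom base_alg A :=
  @AlgHom _ base_alg A (str A) (fun=> erefl).

Lemma pt_one_str (A : Alg O) b :
  pt_fun (1%g : points G A) b = str A (pt_fun (1%g : points G base_alg) b).
Proof. by rewrite -(pt_map1 (base_hom A)). Qed.

(** The universal point: every function on [G] is its own value there. *)
Definition id_point : points G (coordRing G) :=
  @AlgHom _ (coordRing G) (coordRing G) idfun (fun=> erefl).

Lemma pt_fun_combo (A : Alg O) (x : points G A) m (a : 'I_m -> O) e :
  pt_fun x (combo a e) = \sum_(k < m) str A (a k) * pt_fun x (e k).
Proof.
by rewrite /combo rmorph_sum; apply: eq_bigr => k _; rewrite rmorphM alghom_str.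
Qed.

End PointLemmas.

Section Comodule.
Context (O : idomainType) (G : affineGroup O).
Hypotheses (vO : valuation_ring O) (nO : noetherian O)
  (tfG : torsion_free (coordRing G)).

Local Notation B := (coordRing G).

(** Every pair of points is the image of the universal pair, with values in [T]. The value of [f] at
    the product of that pair, written as a sum of tensors, serves for all. *)
Lemma comultiplication (f : B) : exists s : seq (B * B),
  forall (A : Alg O) (x y : points G A),
    pt_fun (x * y)%g f = \sum_(p <- s) pt_fun x p.1 * pt_fun y p.2.
Proof.
have [T [i1 [i2 [gen univ _ _]]]] := tensor_exists B vO tfG.
have [s sP] := gen (pt_fun ((i1 : points G T) * (i2 : points G T))%g f).
exists s => A x y; have [h [h1 h2]] := univ A x y.
have -> : (x * y)%g = pt_map h ((i1 : points G T) * (i2 : points G T))%g.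
  by rewrite pt_mapM /pt_map h1 h2.
rewrite pt_fun_map sP rmorph_sum; apply: eq_bigr => p _.
by rewrite rmorphM -h1 -h2.
Qed.

(* The largest subcomodule of the span of [e]. *)
Definition comodule_core d (e : 'I_d -> B) : set B :=
  [set f | span e f /\ exists b : 'I_d -> B, forall (A : Alg O) (x y : points G A),
     pt_fun (x * y)%g f = \sum_(k < d) pt_fun x (e k) * pt_fun y (b k)].

(* Write [f(xy)] as the sum of the [e_k(x) b_k(y)]. By associativity, the sum of
   the [e_k(xy) b_k(z)] lies in [span e (x) B (x) B]; comparing coordinates in
   the last factor puts suitable combinations of the [e_k] in the core. *)
Lemma comodule_core_stable d (e : 'I_d -> B) f : comodule_core e f ->
  exists m (w n : 'I_m -> B), (forall l, comodule_core e (w l)) /\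
    forall (A : Alg O) (x y : points G A),
      pt_fun (x * y)%g f = \sum_(l < m) pt_fun x (w l) * pt_fun y (n l).
Proof.
move=> [_ [b bP]].
have [T [i1 [i2 [_ univ _ _]]]] := tensor_exists B vO tfG.
have [T3 [j1 [j2 [_ _ inj _]]]] := tensor_exists T vO tfG.
pose u1 : points G T := i1; pose u2 : points G T := i2.
have /choice[s sP] := fun k => comultiplication (b k).
(* Two expressions of f(xyz) with z in the last factor: [l1] from (xy)z, [l2] from x(yz). *)
pose l1 := [seq (pt_fun (u1 * u2)%g (e k), b k) | k <- enum 'I_d].
pose l2 := [seq (i1 (e k) * i2 p.1, p.2) | k <- enum 'I_d, p <- s k].
have [|m [n [a [nP aP]]]] := inj l1 l2.
  rewrite big_map big_allpairs_dep !big_enum /=.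
  pose X := pt_map j1 u1; pose Y := pt_map j1 u2; pose Z : points G T3 := j2.
  transitivity (pt_fun (X * Y * Z)%g f).
    by rewrite bP; apply: eq_bigr => k _; rewrite -pt_mapM.
  rewrite -mulgA bP; apply: eq_bigr => k _.
  rewrite sP mulr_sumr; apply: eq_bigr => p _.
  by rewrite rmorphM mulrA.
pose w l := \sum_(k < d) str B (a (b k) l) * e k.
have bn k : b k = combo (a (b k)) n.
  apply: (nP (pt_fun (u1 * u2)%g (e k), b k)).
  by rewrite mem_cat (map_f (fun k => (pt_fun (u1 * u2)%g (e k), b k))) ?mem_enum.
exists m, w, n; split=> [l|A x y].
  split; first by exists (fun k => a (b k) l).
  exists (fun k => \sum_(p <- s k) str B (a p.2 l) * p.1) => A x y.
  have [h [h1 h2]] := univ A x y.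
  have -> : (x * y)%g = pt_map h (u1 * u2)%g by rewrite pt_mapM /pt_map h1 h2.
  have := congr1 h (aP l); rewrite big_map big_allpairs_dep !big_enum /= => e1.
  rewrite -[LHS]/(h (pt_fun (u1 * u2)%g (w l))) [w l]/(combo (fun k => a (b k) l) e) pt_fun_combo.
  apply: etrans e1 _; rewrite rmorph_sum; apply: eq_bigr => k _.
  rewrite rmorph_sum rmorph_sum mulr_sumr; apply: eq_bigr => p _.
  rewrite !rmorphM !alghom_str -h1 -h2 /=; ring.
rewrite bP; under eq_bigr => k _ do rewrite bn pt_fun_combo mulr_sumr.
rewrite exchange_big; apply: eq_bigr => l _ /=.
rewrite [w l]/(combo (fun k => a (b k) l) e) pt_fun_combo mulr_suml.
by apply: eq_bigr => k _; rewrite mulrCA mulrA.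
Qed.

(** The core of the span of the left tensor factors of the [tau i] contains them. It is finitely
    generated because O is noetherian, and then free because O is a valuation ring and O[G] is
    torsion-free. *)
Lemma finite_comodule n (tau : 'I_n -> B) :
  exists d (v : 'I_d -> B) (M : 'I_d -> 'I_d -> B),
  [/\ lin_indep v, forall i, span v (tau i)
    & forall (A : Alg O) (x y : points G A) j,
        pt_fun (x * y)%g (v j) = \sum_(k < d) pt_fun x (v k) * pt_fun y (M k j)].
Proof.
have /choice[s sP] := fun i => comultiplication (tau i).
have [d [e [ei eP]]] := finite_basis vO tfG
  (flatten [seq [seq p.1 | p <- s i] | i <- enum 'I_n]).
have es i p : p \in s i -> span e p.1.
  move=> ps; apply: eP; apply/flatten_mapP; exists i; first by rewrite mem_enum.
  exact: map_f.
have core_tau i : comodule_core e (tau i).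
  split.
    (* The second tensor factors take values in O at the unit, so the left factors span [tau i] over
       O. *)
    have -> : tau i = pt_fun (id_point G * 1)%g (tau i) by rewrite mulg1.
    rewrite sP big_seq; elim/big_ind: _ => [|x y|p ps].
    - exact: span0.
    - exact: spanD.
    - by rewrite mulrC pt_one_str; apply: spanZ; exact: es ps.
  exists (fun k => \sum_(p <- s i) str B (coord e p.1 k) * p.2) => A x y.
  rewrite sP; under [RHS]eq_bigr do rewrite rmorph_sum mulr_sumr.
  rewrite exchange_big /= big_seq [RHS]big_seq; apply: eq_bigr => p ps.
  rewrite {1}(coordK (es _ _ ps)) pt_fun_combo mulr_suml; apply: eq_bigr => k _.
  rewrite rmorphM alghom_str; ring.
have [||||d' [v' v'E]] := submodule_fg nO (f := e) (V := comodule_core e).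
- split; first exact: span0.
  by exists (fun=> 0) => A x y; rewrite rmorph0 big1 // => k _; rewrite rmorph0 mulr0.
- move=> f g [ef [b bP]] [eg [c cP]]; split; first exact: spanD.
  exists (fun k => b k + c k) => A x y; rewrite rmorphD bP cP -big_split.
  by apply: eq_bigr => k _; rewrite rmorphD mulrDr.
- move=> o f [ef [b bP]]; split; first exact: spanZ.
  exists (fun k => str B o * b k) => A x y; rewrite rmorphM alghom_str bP mulr_sumr.
  by apply: eq_bigr => k _; rewrite rmorphM alghom_str mulrCA.
- by move=> f [].
have [r [v [vi vE]]] := span_basis vO tfG v'.
have vcore j : comodule_core e (v j) by rewrite -v'E -vE; exact: span_mem.
have core_span f : comodule_core e f -> span v f by rewrite vE v'E.
suff /choice[M MP] : forall j, exists M : 'I_r -> B, forall (A : Alg O) (x y : points G A),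
    pt_fun (x * y)%g (v j) = \sum_(k < r) pt_fun x (v k) * pt_fun y (M k).
  exists r, v, (fun k j => M j k); split=> // i; exact: core_span.
move=> j; have [m [w [c [wcore wP]]]] := comodule_core_stable (vcore j).
exists (fun k => \sum_(l < m) str B (coord v (w l) k) * c l) => A x y.
rewrite wP; under [RHS]eq_bigr do rewrite rmorph_sum mulr_sumr.
rewrite exchange_big /=; apply: eq_bigr => l _.
rewrite {1}(coordK (core_span _ (wcore l))) pt_fun_combo mulr_suml.
apply: eq_bigr => k _; rewrite rmorphM alghom_str; ring.
Qed.

Section MatrixCoefficients.
Context (d : nat) (v : 'I_d -> B) (M : 'I_d -> 'I_d -> B).
Hypotheses (vi : lin_indep v) (vM : forall (A : Alg O) (x y : points G A) j,
  pt_fun (x * y)%g (v j) = \sum_(k < d) pt_fun x (v k) * pt_fun y (M k j)).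

(** Values at the unit come from O, so expanding v_j at (universal point) times 1 gives a relation
    over O, where [v] is independent. *)
Lemma matrix_coef_one (A : Alg O) k j :
  pt_fun (1%g : points G A) (M k j) = (k == j)%:R.
Proof.
rewrite pt_one_str -(rmorph_nat (str A)); congr (str A _).
apply/eqP; rewrite -subr_eq0; apply/eqP.
apply: (vi (a := fun k => pt_fun (1%g : points G (base_alg O)) (M k j) - (k == j)%:R)).
rewrite /combo; under eq_bigr do rewrite rmorphB mulrBl.
rewrite sumrB; apply/eqP; rewrite subr_eq0; apply/eqP; transitivity (v j).
  rewrite -[RHS]/(pt_fun (id_point G) (v j)) -[id_point G]mulg1 vM.
  by apply: eq_bigr => l _; rewrite mulrC -pt_one_str.
rewrite (bigD1 j) //= eqxx rmorph1 mul1r big1 ?addr0 // => l /negPf ->.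
by rewrite rmorph0 mul0r.
Qed.

(** Associativity gives the identity only after multiplication by v_k(x) and summation over k, and
    over [A] the v_k may be dependent. At universal points x, y, z, coordinates in the factor
    containing y and z leave relations between the v_k over O. *)
Lemma matrix_coefM (A : Alg O) (y z : points G A) k i :
  pt_fun (y * z)%g (M k i) = \sum_(j < d) pt_fun y (M k j) * pt_fun z (M j i).
Proof.
have [T [i1 [i2 [_ univ _ tfT]]]] := tensor_exists B vO tfG.
have [T3 [j1 [j2 [_ _ inj _]]]] := tensor_exists B vO (tfT tfG).
pose u1 : points G T := i1; pose u2 : points G T := i2.
pose c k := pt_fun (u1 * u2)%g (M k i).
pose c' k := \sum_(j < d) pt_fun u1 (M k j) * pt_fun u2 (M j i).
suff cc' : c k = c' k.
  have [h [h1 h2]] := univ A y z.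
  have -> : (y * z)%g = pt_map h (u1 * u2)%g by rewrite pt_mapM /pt_map h1 h2.
  rewrite pt_fun_map -/(c k) cc' rmorph_sum; apply: eq_bigr => j _.
  by rewrite rmorphM -h1 -h2.
have [|m [n [a [nP aP]]]] := inj [seq (v k, c k) | k <- enum 'I_d]
                                 [seq (v k, c' k) | k <- enum 'I_d].
  rewrite [LHS]big_map [RHS]big_map 2!big_enum /=.
  pose X : points G T3 := j1; pose Y := pt_map j2 u1; pose Z := pt_map j2 u2.
  transitivity (pt_fun (X * (Y * Z))%g (v i)).
    by rewrite vM; apply: eq_bigr => k' _; rewrite -pt_mapM.
  rewrite mulgA vM; under [LHS]eq_bigr do rewrite vM mulr_suml.
  rewrite exchange_big; apply: eq_bigr => k' _ /=.
  rewrite rmorph_sum mulr_sumr; apply: eq_bigr => j _.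
  by rewrite rmorphM mulrA.
have cn : c k = combo (a (c k)) n.
  by apply: (nP (v k, c k)); rewrite mem_cat (map_f (fun k => (v k, c k))) ?mem_enum.
have c'n : c' k = combo (a (c' k)) n.
  by apply: (nP (v k, c' k)); rewrite mem_cat (map_f (fun k => (v k, c' k))) ?orbT ?mem_enum.
rewrite cn c'n; congr combo; apply/funext => l.
have := aP l; rewrite [LHS]big_map [RHS]big_map 2!big_enum /= => /eqP; rewrite -subr_eq0 -sumrB => /eqP e.
apply/eqP; rewrite -subr_eq0; apply/eqP.
apply: (vi (a := fun k => a (c k) l - a (c' k) l)); rewrite -[RHS]e /combo.
by apply: eq_bigr => k' _; rewrite rmorphB mulrBl.
Qed.

End MatrixCoefficients.
End Comodule.

(** * Characteristic polynomials as invariant functions *)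

Lemma char_poly_conjugate (R : comNzRingType) n (P N P' : 'M[R]_n) :
  P *m P' = 1%:M -> char_poly (P *m N *m P') = char_poly N.
Proof.
move=> PP'; pose f := map_mx (@polyC R) : 'M[R]_n -> 'M[{poly R}]_n.
have fPP' : f P *m f P' = 1%:M by rewrite /f -map_mxM PP' map_mx1.
have e : char_poly_mx (P *m N *m P') = f P *m char_poly_mx N *m f P'.
  rewrite /char_poly_mx mulmxBr mulmxBl !map_mxM; congr (_ - _).
  by rewrite mul_mx_scalar -scalemxAl fPP' scalemx1.
rewrite /char_poly e !det_mulmx mulrAC -det_mulmx fPP' det1 mul1r.
by [].
Qed.

Lemma char_poly_scalar1 (R : comNzRingType) n :
  char_poly (1%:M : 'M[R]_n) = ('X - 1%:P) ^+ n.
Proof. by rewrite /char_poly /char_poly_mx map_scalar_mx -raddfB /= det_scalar. Qed.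

Lemma char_poly_relation (R : comNzRingType) n (N : 'M[R]_n.+1) a b :
  \sum_(j < n.+2) (char_poly N)`_j * (N ^+ j) a b = 0.
Proof.
have e : horner_mx N (char_poly N) = \sum_(j < n.+2) (char_poly N)`_j *: N ^+ j.
  rewrite -[in LHS](coefK (char_poly N)) poly_def size_char_poly raddf_sum /=.
  by apply: eq_bigr => j _; rewrite linearZ /= rmorphXn /= horner_mx_X.
have := congr1 (fun X : 'M[R]_n.+1 => X a b) (Cayley_Hamilton N).
by rewrite e summxE mxE => h; rewrite -[RHS]h; apply: eq_bigr => j _; rewrite mxE.
Qed.

(** Equality of structures, not a mere isomorphism, so that [subst] replaces [A] by a nonzero ring
    everywhere. *)
Lemma pack_nonzero (A : comPzRingType) : (1 : A) != 0 ->
  exists R : comNzRingType, (R : comPzRingType) = A.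
Proof.
move=> A1; exists (HB.pack_for comNzRingType (A : Type) A
  (GRing.PzSemiRing_isNonZero.Build A A1)).
by case: A A1.
Qed.

Fixpoint mx_pow (B : comPzRingType) d (M : 'I_d -> 'I_d -> B) (j : nat) :
    'I_d -> 'I_d -> B :=
  if j is j'.+1 then fun a b => \sum_(k < d) mx_pow M j' a k * M k b
  else fun a b => (a == b)%:R.

(** The characteristic polynomial of the identity, over the integers so that its coefficients have a
    meaning in every ring. *)
Definition unipotent_coef (d j : nat) : int := (('X - 1%:P) ^+ d : {poly int})`_j.

(* Stated for rings that may be zero, to which [char_poly] does not apply. *)
Lemma char_poly_coefficients (B : comPzRingType) d (M : 'I_d -> 'I_d -> B) :
  (1 : B) != 0 -> exists c : nat -> B,
  [/\ forall a b, \sum_(j < d.+1) c j * mx_pow M j a b = 0,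
      forall (A : comPzRingType) (f : {rmorphism B -> A}) j,
        (forall a b, f (M a b) = (a == b)%:R) -> f (c j) = (unipotent_coef d j)%:~R
    & forall (A : comPzRingType) (f g h h' : {rmorphism B -> A}) j,
        (forall a b, \sum_(k < d) h (M a k) * h' (M k b) = (a == b)%:R) ->
        (forall a b, g (M a b) =
           \sum_(l < d) (\sum_(k < d) h (M a k) * f (M k l)) * h' (M l b)) ->
        g (c j) = f (c j)].
Proof.
move=> /pack_nonzero[R e]; subst B.
pose N : 'M[R]_d := \matrix_(a, b) M a b.
have NM A (f : {rmorphism R -> A}) a b : map_mx f N a b = f (M a b) by rewrite !mxE.
exists (fun j => (char_poly N)`_j); split.
- have : forall a b, N a b = M a b by move=> a b; rewrite mxE.
  case: d M N {NM} => [|d] M N NM a b; first by case: a.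
  rewrite -[RHS](char_poly_relation N a b); apply: eq_bigr => j _; congr (_ * _).
  elim: (j : nat) a b => [|i IHi] a b; first by rewrite expr0 mxE.
  by rewrite exprSr mxE; apply: eq_bigr => k _; rewrite -IHi NM.
- move=> A f j fM; have [A0|A1] := eqVneq (1 : A) 0.
    by rewrite -[LHS]mul1r A0 mul0r -[RHS]mul1r A0 mul0r.
  have [A' e] := pack_nonzero A1; subst A.
  have -> : f (char_poly N)`_j = (char_poly (map_mx f N))`_j.
    by rewrite -map_char_poly coef_map.
  have -> : map_mx f N = 1%:M by apply/matrixP => a b; rewrite NM fM mxE.
  rewrite char_poly_scalar1 /unipotent_coef -(coef_map (intr : {rmorphism int -> A'})).
  by rewrite rmorphXn rmorphB /= map_polyX map_polyC /= rmorph1.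
- move=> A f g h h' j hh' gM; have [A0|A1] := eqVneq (1 : A) 0.
    by rewrite -[LHS]mul1r A0 mul0r -[RHS]mul1r A0 mul0r.
  have [A' e] := pack_nonzero A1; subst A.
  rewrite -!(coef_map _ (char_poly N)) !map_char_poly.
  rewrite -(@char_poly_conjugate _ _ (map_mx h N) (map_mx f N) (map_mx h' N)).
    congr (char_poly _)`_j; apply/matrixP => a b; rewrite NM gM !mxE.
    apply: eq_bigr => l _; rewrite NM mxE; congr (_ * _).
    by apply: eq_bigr => k _; rewrite !NM.
  by apply/matrixP => a b; rewrite !mxE -hh'; apply: eq_bigr => k _; rewrite !NM.
Qed.

Section InvariantRelation.
Context (O : idomainType) (G : affineGroup O).
Hypotheses (vO : valuation_ring O) (nO : noetherian O)
  (tfG : torsion_free (coordRing G)).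

Program Definition element_fun (b : coordRing G) : regFun G 1 :=
  @RegFun _ _ _ (fun A g => pt_fun (g ord0) b) _.
Next Obligation. by []. Qed.

(** [sigma j] is the j-th coefficient of the characteristic polynomial of the generic matrix [M] of
    a comodule containing the [tau i]; it is invariant under conjugation by all of [G]. The comodule
    formula, applied on each side of [h ^+ j], brings in [x] and [z]. *)
Lemma invariant_relation n (tau : 'I_n -> coordRing G) :
  exists d (sigma : nat -> invFun G 1),
    (forall (A : Alg O) (x h z : points G A) i,
      \sum_(j < d.+1) sigma j A (fun=> h) * pt_fun (x * h ^+ j * z)%g (tau i) = 0) /\
    forall (A : Alg O) j, sigma j A (fun=> 1%g) = (unipotent_coef d j)%:~R.
Proof.
have [d [v [M [vi vtau vM]]]] := finite_comodule vO nO tfG tau.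
have Mone := matrix_coef_one vi vM; have MM := matrix_coefM vO tfG vi vM.
have B1 : (1 : coordRing G) != 0.
  apply: contra_neq (oner_neq0 O) => e.
  by rewrite -(rmorph1 (pt_fun (1%g : points G (base_alg O)))) e rmorph0.
have [c [crel c1 cconj]] := char_poly_coefficients M B1.
have cinv j : conj_invariant (element_fun (c j)).
  move=> A h g _ /=; apply: (cconj _ _ _ (pt_fun h) (pt_fun h^-1%g)) => a b.
    by rewrite -MM mulgV Mone.
  rewrite MM; apply: eq_bigr => l _; congr (_ * _); exact: MM.
exists d, (fun j => @Defs.InvFun _ _ _ _ (cinv j)); split=> [A x h z i|A j] /=; last exact: c1.
have [a ->] := vtau i.
have vpow j b : pt_fun (x * h ^+ j)%g (v b) =
    \sum_(l < d) pt_fun x (v l) * pt_fun h (mx_pow M j l b).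
  elim: j b => [|j IHj] b.
    rewrite expg0 mulg1 (bigD1 b) //= eqxx rmorph1 mulr1 big1 ?addr0 // => l /negPf ->.
    by rewrite rmorph0 mulr0.
  rewrite expgSr mulgA vM; under eq_bigr do rewrite IHj mulr_suml.
  rewrite exchange_big; apply: eq_bigr => l _ /=; rewrite rmorph_sum mulr_sumr.
  by apply: eq_bigr => k _; rewrite rmorphM mulrA.
have vrel b : \sum_(j < d.+1) pt_fun h (c j) * pt_fun (x * h ^+ j)%g (v b) = 0.
  under eq_bigr do rewrite vpow mulr_sumr.
  rewrite exchange_big big1 //= => l _.
  under eq_bigr do rewrite mulrCA -rmorphM.
  by rewrite -mulr_sumr -rmorph_sum crel rmorph0 mulr0.
under eq_bigr do rewrite pt_fun_combo mulr_sumr.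
rewrite exchange_big big1 //= => k _; under eq_bigr do rewrite mulrCA vM mulr_sumr.
rewrite -mulr_sumr exchange_big big1 ?mulr0 //= => b _.
under eq_bigr do rewrite mulrA.
by rewrite -mulr_suml vrel mul0r.
Qed.

End InvariantRelation.

(** * Profinite rings and their modules *)

Section CompactSpaces.

(** In a compact Hausdorff space the quasi-component [Q] of [x] is connected: normality extends a
    separation of [Q] to disjoint open sets, and a clopen set fits between [Q] and their union. *)
Lemma compact_totally_disconnected (T : topologicalType) :
  profinite T -> zero_dimensional T.
Proof.
move=> [cT hT tdT] x y /eqP xy; apply: contrapT => noU.
have clopen_y U : clopen U -> U x -> U y.
  by move=> cU Ux; apply: contrapT => nUy; apply: noU; exists U.
pose Q := \bigcap_(U in [set U : set T | clopen U /\ U x]) U.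
have Qx : Q x by move=> U [].
have Qy : Q y by move=> U [cU Ux]; exact: clopen_y.
have clQ : closed Q by apply: closed_bigI => U [[]].
(* Otherwise the sets [U] minus [W], for [U] clopen containing [x], have a cluster point; it lies in
   [Q] but not in [W]. *)
have shrink W : open W -> Q `<=` W -> exists U, [/\ clopen U, U x & U `<=` W].
  move=> oW QW; apply: contrapT => nU.
  pose F := filter_from [set U : set T | clopen U /\ U x] (fun U => U `&` ~` W).
  have FF : ProperFilter F.
    apply: filter_from_proper => [|U [cU Ux]]; last first.
      apply: contrapT => /set0P/negP/negPn/eqP UW; apply: nU; exists U; split=> //.
      exact/subsets_disjoint.
    apply: filter_from_filter; first by exists setT; split=> //; exact: clopenT.
    move=> U V [cU Ux] [cV Vx]; exists (U `&` V).
      by split=> //; exact: clopenI.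
    by move=> z [[Uz Vz] nWz].
  have [p [_ clp]] := cT F FF filterT.
  have pUW U : clopen U -> U x -> (U `&` ~` W) p.
    move=> cU Ux; have : closed (U `&` ~` W).
      by apply: closedI; [case: cU|exact: open_closedC].
    move/closure_id ->; rewrite clusterE in clp; apply: clp.
    by exists U.
  have [] := pUW setT clopenT I => _; apply; apply: QW => U [cU Ux].
  by have [] := pUW U cU Ux.
have conQ : connected Q.
  move=> B [b Bb] [C oC BC] [D cD BD]; apply: contrapT => BQ.
  have clB : closed B by rewrite BD; exact: closedI.
  have [z [Qz nBz]] : exists z, Q z /\ ~ B z.
    apply: contrapT => /forallNP h; apply: BQ; apply/seteqP; split.
      by rewrite BC => ? [].
    by move=> z Qz; apply: contrapT => nBz; apply: (h z).
  have clB' : closed (Q `&` ~` C) by apply: closedI => //; exact: open_closedC.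
  have BB' : set_nbhs B (~` (Q `&` ~` C)).
    apply/set_nbhsP; exists (~` (Q `&` ~` C)); split=> //; first exact: closed_openC.
    by move=> w; rewrite {1}BC => -[_ Cw] [].
  have [V /set_nbhsP [W1 [oW1 BW1 W1V]] VB'] := compact_normal hT cT clB BB'.
  pose W2 := ~` closure V.
  have W12 w : W1 w -> W2 w -> False by move=> /W1V/subset_closure.
  have oW2 : open W2 by apply/closed_openC/closed_closure.
  have cover w : Q w -> W1 w \/ W2 w.
    move=> Qw; have [Bw|nBw] := pselect (B w); [left; exact: BW1|right].
    by move=> /VB'; apply; split=> // Cw; apply: nBw; rewrite BC.
  have [U [cU Ux UO]] := shrink (W1 `|` W2) (openU oW1 oW2) cover.
  (* The part of [U] in the open set containing [x] is clopen, since the other open set is its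
     complement in [U]; hence it contains [Q]. *)
  have half P P' : open P -> open P' -> U `<=` P `|` P' -> (forall w, P w -> P' w -> False) ->
      P x -> Q `<=` P.
    move=> oP oP' UPP' dis Px w; apply: contraPP => nPw Qw.
    suff cUP : clopen (U `&` P) by have [_ /nPw] := Qw (U `&` P) (conj cUP (conj Ux Px)).
    split; first by apply: openI => //; case: cU.
    rewrite (_ : _ `&` _ = U `&` ~` P').
      by apply: closedI; [case: cU|exact: open_closedC].
    apply/seteqP; split=> t [Ut]; first by move=> Pt; split=> // /(dis t Pt).
    by move=> nP't; split=> //; have [] := UPP' t Ut.
  have [W1x|W2x] := cover x Qx.
    have := half W1 W2 oW1 oW2 UO W12 W1x z Qz => W1z.
    have [_|W2z] := cover z Qz; last exact: W12 W2z.
    have : (~` closure V) z; last by move: W1z => /W1V/subset_closure.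
    by move=> /VB'; apply; split=> // Cz; apply: nBz; rewrite BC.
  have W2b : W2 b.
    apply: (half W2 W1) => //; first by move=> t /UO []; [right|left].
      by move=> w ? ?; exact: (W12 w).
    by move: Bb; rewrite BC => -[].
  exact: (W12 b (BW1 _ Bb) W2b).
have : connected_component setT x y.
  by apply: (connected_component_max Qx _ conQ) => //.
by rewrite tdT // => /= yx; apply: xy.
Qed.

Lemma clopen_nbhs (T : topologicalType) (x : T) U :
  profinite T -> nbhs x U -> exists D, [/\ clopen D, D x & D `<=` U].
Proof.
move=> pT Ux; have [cT hT _] := pT.
have [D [Dx cD] DU] := zero_dimensional_cvg hT (compact_totally_disconnected pT) cT Ux.
by exists D.
Qed.

(** The tube lemma. *)
Lemma open_forall_compact (K X : topologicalType) (W : set (K * X)) :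
  compact [set: K] -> open W -> open [set x | forall t, W (t, x)].
Proof.
move=> /compact_near_coveringP cK oW; rewrite openE => x /= Wx.
have cover t : [set: K] t ->
    \forall t' \near t & x' \near nbhs x, W (t', x').
  move=> _; have : nbhs (t, x) W := open_nbhs_nbhs (conj oW (Wx t)).
  by case=> -[A B] /= AB ABW; exists (A, B) => // -[t' x'] /= h; exact: ABW.
have H := cK X (nbhs x) (fun x t => W (t, x)) (nbhs_filter x) cover.
by apply: (@filterS X (nbhs x) _ _ _ _ H) => x' h t; exact: h.
Qed.

End CompactSpaces.

Lemma continuous_pair (X A B C : topologicalType) (op : A * B -> C)
    (f : X -> A) (g : X -> B) :
  continuous op -> continuous f -> continuous g ->
  continuous (fun x => op (f x, g x)).
Proof.
move=> cop cf cg x; apply: (@continuous_comp _ _ _ (fun x => (f x, g x)) op).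
  by apply: cvg_pair; [exact: cf|exact: cg].
exact: cop.
Qed.

Lemma continuous_compose (X A B : topologicalType) (g : A -> B) (f : X -> A) :
  continuous g -> continuous f -> continuous (fun x => g (f x)).
Proof. by move=> cg cf x; apply: continuous_comp; [exact: cf|exact: cg]. Qed.

Lemma open_preimage (A B : topologicalType) (f : A -> B) U :
  continuous f -> open U -> open (f @^-1` U).
Proof. by move=> cf oU; apply: open_comp => // x _; exact: cf. Qed.

Lemma continuous_fst (A B : topologicalType) : continuous (@fst A B).
Proof. by move=> x; exact: cvg_fst. Qed.

Lemma continuous_snd (A B : topologicalType) : continuous (@snd A B).
Proof. by move=> x; exact: cvg_snd. Qed.

Lemma continuous_sum (X : topologicalType) (M : topologicalZmodType) n
    (F : 'I_n -> X -> M) :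
  (forall i, continuous (F i)) -> continuous (fun x => \sum_(i < n) F i x).
Proof.
elim: n F => [|n IHn] F cF.
  by under eq_fun do rewrite big_ord0; move=> x; exact: cvg_cst.
under eq_fun do rewrite big_ord_recl.
by apply: (continuous_pair (@add_continuous M)) => //; exact: IHn.
Qed.

(* If [D] is a clopen neighbourhood of 0, the elements [x] with
   [D + R x] contained in [D] form an ideal, open by compactness. *)
Lemma open_ideal (R : topComRingType) (U : set R) : profinite R -> nbhs 0 U ->
  exists I : set R, [/\ is_ideal I, open I & I `<=` U].
Proof.
move=> pR /(clopen_nbhs pR)[D [[oD cD] D0 DU]].
(* An implication written as a disjunction: it defines an open set because [D] is clopen. *)
pose W := [set z : (R * R) * R | ~ D z.1.2 \/ D (z.1.2 + z.1.1 * z.2)].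
have oW : open W.
  have -> : W = (fun z => z.1.2) @^-1` (~` D) `|`
                (fun z => z.1.2 + z.1.1 * z.2) @^-1` D by [].
  have c12 : continuous (fun z : (R * R) * R => z.1.2).
    by apply: continuous_compose; [exact: continuous_snd|exact: continuous_fst].
  have c11 : continuous (fun z : (R * R) * R => z.1.1).
    by apply: continuous_compose; exact: continuous_fst.
  apply: openU.
    by apply: open_preimage c12 _; exact: closed_openC.
  apply: (open_preimage _ oD).
  apply: (continuous_pair (@add_continuous R) c12).
  exact: (continuous_pair (@mulr_continuous R) c11 (@continuous_snd _ _)).
have cRR : compact [set: R * R].
  by rewrite -setXTT; apply: compact_setX; case: pR.
exists [set x | forall t, W (t, x)]; split; last 2 first.
- exact: open_forall_compact.
- move=> x /(_ (1, 0))[]//=; rewrite add0r mul1r; exact: DU.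
split=> [t|x y Wx Wy t|a x Wx [t1 t2]].
- by rewrite /W /= mulr0 addr0; case: (pselect (D t.2)); [right|left].
- have [|h] := pselect (D t.2); last by left.
  have [//|Dx _] := Wx t; rewrite /= in Dx.
  have [//|Dy] := Wy (t.1, t.2 + t.1 * x).
  by right; rewrite /= mulrDr addrA.
- by have := Wx (t1 * a, t2); rewrite /W /= mulrA.
Qed.

Section TopologicalModule.
Context (R : topComRingType) (M : topologicalZmodType) (scale : R -> M -> M).
Hypotheses (scaleDr : forall r x y, scale r (x + y) = scale r x + scale r y)
  (scaleDl : forall r s x, scale (r + s) x = scale r x + scale s x)
  (scaleA : forall r s x, scale (r * s) x = scale r (scale s x)).
Hypothesis scale_cont : continuous (fun x : R * M => scale x.1 x.2).

Lemma scale0l x : scale 0 x = 0.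
Proof. by apply: (addrI (scale 0 x)); rewrite -scaleDl !addr0. Qed.

Lemma scale0r r : scale r 0 = 0.
Proof. by apply: (addrI (scale r 0)); rewrite -scaleDr !addr0. Qed.

Lemma scale_sumr r n (F : 'I_n -> M) :
  scale r (\sum_(i < n) F i) = \sum_(i < n) scale r (F i).
Proof. by elim/big_rec2: _ => [|i y1 y2 _ <-]; rewrite ?scale0r ?scaleDr. Qed.

Lemma nbhs_sum n (U : set M) : nbhs 0 U -> exists2 V : set M, nbhs 0 V &
  forall y : 'I_n -> M, (forall i, V (y i)) -> U (\sum_(i < n) y i).
Proof.
elim: n U => [|n IHn] U U0.
  by exists setT; [exact: filterT|move=> y _; rewrite big_ord0; exact: nbhs_singleton].
have := @add_continuous M (0, 0) U; rewrite /= addr0 => /(_ U0)[[A B] /= [A0 B0] AB].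
have [V V0 VB] := IHn B B0; exists (A `&` V); first exact: filterI.
move=> y Vy; rewrite big_ord_recl; apply: (AB (_, _)); split=> /=.
  by have [] := Vy ord0.
by apply: VB => i; have [] := Vy (lift ord0 i).
Qed.

Hypotheses (pR : profinite R) (hM : hausdorff_space M).
Context (d : nat) (m : 'I_d -> M).
Hypothesis genM : forall x, exists c : 'I_d -> R, x = \sum_(j < d) scale (c j) (m j).

(** [N] is I M, the sum of the I m_j, with [I] so small that these sums avoid [x]. Its preimage in
    R^d is open, being stable under I^d, and R^d, being compact, maps onto the Hausdorff [M] by a
    closed map. *)
Lemma open_submodule (x : M) : x <> 0 -> exists (I : set R) (N : set M),
  [/\ is_ideal I /\ open I, open N,
      [/\ N 0, forall y z, N y -> N z -> N (y + z) & forall r y, N y -> N (scale r y)],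
      forall r y, I r -> N (scale r y) & ~ N x].
Proof.
move=> x0; have U0 : nbhs 0 (~` [set x]).
  apply: open_nbhs_nbhs; split; last by move=> /= e; apply: x0.
  exact/closed_openC/(accessible_closed_set1 (hausdorff_accessible hM)).
have [V V0 VU] := nbhs_sum d U0.
have scale_m j : continuous (fun r => scale r (m j)).
  by apply: (continuous_pair (f := id) (g := fun=> m j) scale_cont) => r;
    [exact: cvg_id|exact: cvg_cst].
have [|I [hI oI IV]] := @open_ideal R [set r | forall j, V (scale r (m j))] pR.
  apply: filter_forall => j; apply: (scale_m j 0 V); by rewrite scale0l.
pose f (c : prod_topology (fun _ : 'I_d => (R : topologicalType))) : M :=
  \sum_(j < d) scale (c j) (m j).
pose N := [set y | exists2 c : 'I_d -> R, (forall j, I (c j)) & y = f c].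
have [I0 ID IM] := hI.
have fD c c' : f c + f c' = f (fun j => c j + c' j).
  by rewrite /f -big_split; apply: eq_bigr => j _; rewrite scaleDl.
have cf : continuous f.
  apply: continuous_sum => j; apply: continuous_compose (scale_m j) _.
  exact: proj_continuous.
have cP : compact [set: prod_topology (fun _ : 'I_d => (R : topologicalType))].
  have [cR _ _] := pR.
  rewrite (_ : setT = [set c | forall j, [set: R] (c j)]); last by apply/seteqP.
  exact: (@tychonoff _ (fun _ : 'I_d => (R : topologicalType)) (fun=> setT) (fun=> cR)).
have oN' : open (f @^-1` N).
  rewrite openE => c [e eI fce].
  suff : \forall c' \near c, forall j, I (c' j - c j).
    apply: filterS => c' hc'; exists (fun j => e j + (c' j - c j)).
      by move=> j; apply: ID.
    rewrite -fD -fce fD /f; apply: eq_bigr => j _; congr (scale _ _).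
    by rewrite addrC subrK.
  apply: (@filter_forall _ _ (fun j => [set c' | I (c' j - c j)]) (nbhs c)) => j.
  apply: (@proj_continuous _ _ j c [set r | I (r - c j)]).
  apply: open_nbhs_nbhs; split; last by rewrite /= /proj subrr.
  apply: (open_preimage _ oI).
  by apply: (continuous_pair (f := id) (g := fun=> c j) (@sub_continuous R)) => r;
    [exact: cvg_id|exact: cvg_cst].
exists I, N; split=> //.
- suff cN : compact (~` N).
    by rewrite -[N]setCK; exact/closed_openC/(compact_closed hM).
  rewrite (_ : ~` N = f @` (~` (f @^-1` N))).
    apply: continuous_compact; first exact: continuous_subspaceT.
    by apply: subclosed_compact cP _ => //; exact: open_closedC.
  apply/seteqP; split=> y; last by move=> [c nN <-].
  move=> nN; have [c yc] := genM y; have fc : f c = y by [].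
  by exists c => //=; rewrite fc.
- split.
  + exists (fun=> 0) => //; rewrite /f big1 // => j _; exact: scale0l.
  + move=> _ _ [c Ic ->] [c' Ic' ->]; rewrite fD.
    by exists (fun j => c j + c' j) => // j; exact: ID.
  + move=> r _ [c Ic ->]; rewrite scale_sumr; exists (fun j => r * c j).
      by move=> j; exact: IM.
    by apply: eq_bigr => j _; rewrite scaleA.
- move=> r y Ir; have [c ->] := genM y; rewrite scale_sumr; exists (fun j => r * c j).
    by move=> j; rewrite mulrC; exact: IM.
  by apply: eq_bigr => j _; rewrite scaleA.
- move=> [c Ic xc]; apply: (VU (fun j => scale (c j) (m j))); last by rewrite /= xc.
  by move=> j; exact: IV.
Qed.

End TopologicalModule.

(** * Unipotent operators *)

Section Radical.
Context (R : comPzRingType) (J : set R).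
Hypothesis hJ : is_ideal J.

Definition ideal_radical : set R := [set x | exists n, J (x ^+ n)].

Lemma ideal_exp_le x m n : (m <= n)%N -> J (x ^+ m) -> J (x ^+ n).
Proof. by move=> /subnK <- Jx; rewrite exprD; case: hJ => _ _; apply. Qed.

Lemma ideal_radical_ideal : is_ideal ideal_radical.
Proof.
have [J0 JD JM] := hJ; split.
- by exists 1%N; rewrite expr1.
- move=> x y [m Jx] [n Jy]; exists (m + n)%N; rewrite exprDn.
  apply: ideal_sum => // i; rewrite -mulr_natl; apply: (JM).
  have [lei|lti] := leqP n i; first exact/JM/(ideal_exp_le lei).
  rewrite mulrC; apply/JM/ideal_exp_le/Jx; move: lti; lia.
- by move=> a x [n Jx]; exists n; rewrite exprMn; exact: JM.
Qed.

Lemma ideal_expB x y n : J (x - y) -> J (x ^+ n - y ^+ n).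
Proof. by move=> h; rewrite subrXX mulrC; case: hJ => _ _; apply. Qed.

End Radical.

Section PrimePowers.
Context (p : nat) (p_prime : prime p) (R : comPzRingType).

Lemma frobenius_step (x y : R) :
  exists z, (x + y) ^+ p = x ^+ p + y ^+ p + p%:R * z.
Proof.
case: p p_prime => // q q_prime.
exists (\sum_(i < q) x ^+ (q - i) * y ^+ i.+1 *+ ('C(q.+1, i.+1) %/ q.+1)).
rewrite exprDn big_ord_recl big_ord_recr /= subn0 expr0 mulr1 bin0 mulr1n.
rewrite /bump /= add1n subnn expr0 mul1r binn mulr1n -addrA [_ + y ^+ _]addrC.
congr (_ + (_ + _)); rewrite mulr_sumr; apply: eq_bigr => i _.
rewrite mulr_natl -mulrnA divnK ?add1n ?subSS //.
by apply: prime_dvd_bin => //=; rewrite ltnS.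
Qed.

Lemma frobenius_iter (x : R) s :
  exists y, (1 + x) ^+ (p ^ s) = 1 + x ^+ (p ^ s) + p%:R * y.
Proof.
elim: s => [|s [y IHs]]; first by exists 0; rewrite expn0 !expr1 mulr0 addr0.
rewrite expnSr !exprM IHs.
have [z ->] := frobenius_step (1 + x ^+ (p ^ s)) (p%:R * y).
have [w ->] := frobenius_step 1 (x ^+ (p ^ s)).
exists (w + y * (p%:R * y) ^+ p.-1 + z).
have -> : (p%:R * y) ^+ p = p%:R * y * (p%:R * y) ^+ p.-1.
  by rewrite -exprS prednK ?prime_gt0.
by rewrite expr1n !mulrDr !addrA mulrA.
Qed.

Lemma one_add_prime_iter (y : R) t :
  exists z, (1 + p%:R * y) ^+ (p ^ t) = 1 + p%:R ^+ t.+1 * z.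
Proof.
elim: t => [|t [z IHt]]; first by exists y; rewrite expn0 !expr1.
rewrite expnSr exprM IHt.
set u := p%:R ^+ t.+1 * z.
(* (1 + u)^p - 1 is u times the sum of the (1 + u)^i; modulo u that sum is p, which supplies the
   additional factor p. *)
have /choice[w wP] : forall i : 'I_p, exists w, (1 + u) ^+ i = 1 + u * w.
  move=> i; exists (\sum_(j < i) (1 + u) ^+ j).
  by apply: (addIr (- 1)); rewrite [RHS]addrAC subrr add0r subrX1 [1 + u]addrC addrK.
exists (z * (1 + p%:R ^+ t * z * \sum_i w i)).
apply: (addIr (- 1)); rewrite subrX1 (eq_bigr _ (fun i _ => wP i)) big_split /=.
rewrite -mulr_sumr sumr_const card_ord /u !exprS; ring.
Qed.

(** As p^n > n, raising to the power p^n removes [x] up to a multiple of p; raising then to p^m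
    turns that multiple into one of p^(m+1). *)
Lemma one_add_nilpotent_power (J : set R) x :
  is_ideal J -> ideal_radical J x -> ideal_radical J p%:R ->
  exists e, J ((1 + x) ^+ (p ^ e) - 1).
Proof.
move=> hJ [n Jx] [m Jp]; have [J0 JD JM] := hJ.
have [y xy] := frobenius_iter x n; have [z yz] := one_add_prime_iter y m.
exists (n + m)%N; rewrite expnD exprM xy.
set u := 1 + x ^+ (p ^ n) + p%:R * y.
(* [u] and 1 + p y differ by x^(p^n), which is in [J], so their powers agree modulo [J]. *)
have -> : u ^+ (p ^ m) - 1 =
    u ^+ (p ^ m) - (1 + p%:R * y) ^+ (p ^ m) + z * p%:R * p%:R ^+ m.
  by rewrite yz exprS opprD addrA -[RHS]addrA [z * _]mulrC mulrAC addNr addr0.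
apply: JD; last exact: JM.
apply: ideal_expB => //; rewrite (_ : _ - _ = x ^+ (p ^ n)); last by rewrite /u; ring.
by apply: ideal_exp_le Jx => //; apply/ltnW/ltn_expl/prime_gt1.
Qed.

End PrimePowers.

(* The operator induced by [s] on the functions [f \o iter j s] satisfies a
   polynomial that is [(X - 1) ^ d] up to coefficients nilpotent modulo [I]. *)
Lemma unipotent_power (p : nat) (R : comPzRingType) (M : zmodType)
    (scale : R -> M -> M) (I : set R) (N : set M) (Y : Type) (s : Y -> Y)
    (f : Y -> M) (d : nat) (P : nat -> R) :
  prime p -> (1 : R) != 0 ->
  (forall r x y, scale r (x + y) = scale r x + scale r y) ->
  (forall r q x, scale (r + q) x = scale r x + scale q x) ->
  (forall r q x, scale (r * q) x = scale r (scale q x)) ->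
  (forall x, scale 1 x = x) ->
  is_ideal I ->
  N 0 -> (forall x y, N x -> N y -> N (x + y)) -> (forall r x, N x -> N (scale r x)) ->
  (forall r x, I r -> N (scale r x)) ->
  ideal_radical I p%:R ->
  (forall j, ideal_radical I (P j - (unipotent_coef d j)%:~R)) ->
  (forall y, \sum_(j < d.+1) scale (P j) (f (iter j s y)) = 0) ->
  exists e, forall y, N (f (iter (p ^ e) s y) - f y).
Proof.
move=> p_prime /pack_nonzero[R' e]; subst R => sDr sDl sA s1 hI N0 ND NZ IN Ip IP rel.
pose R := R'; rewrite -/R in scale I P sDr sDl sA s1 hI NZ IN Ip IP rel *.
have s0 x : scale 0 x = 0 by apply: (addrI (scale 0 x)); rewrite -sDl !addr0.
have s0r r : scale r 0 = 0 by apply: (addrI (scale r 0)); rewrite -sDr !addr0.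
(* [th q] is q(s) f: the polynomial [q] in the operator of composition with [s], applied to [f]. *)
pose th (q : {poly R}) y := \sum_(j < size q) scale q`_j (f (iter j s y)).
have thE n (q : {poly R}) y : (size q <= n)%N ->
    th q y = \sum_(j < n) scale q`_j (f (iter j s y)).
  move=> le; rewrite /th (big_ord_widen _ (fun j => scale q`_j (f (iter j s y))) le).
  rewrite big_mkcond; apply: eq_bigr => i _; case: ltnP => // lei.
  by rewrite nth_default.
have thD q q' y : th (q + q') y = th q y + th q' y.
  pose n := maxn (size q) (size q').
  rewrite !(@thE n) ?leq_maxl ?leq_maxr ?size_polyD// -big_split /=.
  by apply: eq_bigr => i _; rewrite coefD sDl.
have thC c q y : th (c%:P * q) y = scale c (th q y).
  rewrite (@thE (size q)); last by rewrite mul_polyC size_scale_leq.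
  rewrite /th; elim/big_rec2: _ => [|i y1 y2 _ ->]; first by rewrite s0r.
  by rewrite sDr coefCM sA.
have thX q y : th (q * 'X) y = th q (s y).
  rewrite (@thE (size q).+1); last first.
    by apply: leq_trans (size_polyMleq _ _) _; rewrite size_polyX addn2.
  rewrite big_ord_recl coefMX s0 add0r /th.
  by apply: eq_bigr => i _; rewrite coefMX -iterSr.
(* All [y] are required because multiplication by X replaces [y] by [s y]; this makes [J] an ideal,
   and the claim becomes X^(p^e) = 1 modulo [J]. *)
pose J := [set q | forall y, N (th q y)].
have hJ : is_ideal J.
  split=> [y|q q' Jq Jq' y|q q' Jq'].
  - by rewrite /th size_poly0 big_ord0.
  - by rewrite thD; exact: ND.
  - elim/poly_ind: q => [|q c IHq] y; first by rewrite mul0r /th size_poly0 big_ord0.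
    by rewrite mulrDl thD thC mulrAC thX; apply: ND; [exact: IHq|exact/NZ/Jq'].
have JI c : I c -> J c%:P.
  by move=> Ic y; rewrite -[c%:P]mulr1 thC; exact: IN.
have radC c : ideal_radical I c -> ideal_radical J c%:P.
  by move=> [n Ic]; exists n; rewrite -rmorphXn; exact: JI.
pose chi := \poly_(j < d.+1) P j.
have Jchi : J chi.
  move=> y; rewrite (@thE d.+1) ?size_poly //.
  rewrite (_ : \sum_(j < _) _ = 0) // -[RHS](rel y).
  by apply: eq_bigr => j _; rewrite coef_poly ltn_ord.
have hrad := ideal_radical_ideal hJ; have [rad0 radD radM] := hrad.
(* [chi] is in [J] and differs from (X - 1)^d by coefficients in the radical of [I], so X - 1 is
   nilpotent modulo [J]. *)
have Xd : ('X - 1%:P) ^+ d = chi - \sum_(j < d.+1)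
    'X^j * (P j - (unipotent_coef d j)%:~R)%:P :> {poly R}.
  have -> : ('X - 1%:P) ^+ d = \poly_(j < d.+1) (unipotent_coef d j)%:~R :> {poly R}.
    transitivity (map_poly (intr : int -> R) (('X - 1%:P) ^+ d)).
      by rewrite rmorphXn rmorphB /= map_polyX map_polyC /= rmorph1.
    apply/polyP => j; rewrite coef_map coef_poly /unipotent_coef; case: ltnP => // lej.
    by rewrite nth_default // size_exp_XsubC.
  rewrite /chi !poly_def -sumrB; apply: eq_bigr => j _.
  by rewrite mulrC mul_polyC -scalerBl opprB addrCA subrr addr0.
have radX : ideal_radical J ('X - 1%:P).
  suff [n Jn] : ideal_radical J (('X - 1%:P) ^+ d) by exists (d * n)%N; rewrite exprM.
  rewrite Xd; apply: (radD); first by exists 1%N; rewrite expr1.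
  by apply: (ideal_opp hrad); apply: ideal_sum => // j; apply/radM/radC.
have radp : ideal_radical J p%:R.
  by rewrite -(rmorph_nat (polyC : {rmorphism R -> {poly R}})); exact: radC.
have [e Je] := one_add_nilpotent_power p_prime hJ radX radp; exists e => y.
have th1 y' : th 1 y' = f y'.
  by rewrite (@thE 1) ?size_poly1// big_ord1 coef1 s1.
have thXn n y' : th 'X^n y' = f (iter n s y').
  elim: n y' => [|n IHn] y'; first by rewrite expr0 th1.
  by rewrite exprSr thX IHn -iterSr.
have := Je y; rewrite polyC1 [1 + _]addrC subrK thD thXn.
have -> : th (- 1) y = - f y; last by [].
by apply: (addrI (f y)); rewrite subrr -{1}(th1 y) -thD subrr /th size_poly0 big_ord0.
Qed.

(** * The kernel of a condensed representation *)

Section RingOfIntegers.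
Context (p : nat) (p_prime : prime p).
Context (Qp : fieldType) (vp : Qp -> int) (hQp : is_Qp p vp).
Context (L : fieldExtType Qp) (v : L -> int) (O : idomainType)
  (iota : {rmorphism O -> L}) (hO : is_ring_of_integers vp v iota).

Let vM x y : x != 0 -> y != 0 -> v (x * y) = v x + v y.
Proof. by have [[h _] _ _ _ _] := hO; exact: h. Qed.

Let v1 : v 1 = 0.
Proof. by apply: (addrI (v 1)); rewrite -vM ?oner_neq0 // mulr1 addr0. Qed.

Let iota_neq0 x : x != 0 -> iota x != 0.
Proof.
have [_ _ _ inj _] := hO; apply: contra_neq => e; apply: inj.
by rewrite e rmorph0.
Qed.

Let v_ge0 x : x != 0 -> 0 <= v (iota x).
Proof.
move=> /iota_neq0 x0; have [_ _ _ _ h] := hO.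
have [] : vge v 0 (iota x) by apply/h; exists x.
  by move=> e; rewrite e eqxx in x0.
by [].
Qed.

Let v_dvd x y : x != 0 -> y != 0 -> v (iota x) <= v (iota y) -> exists z, y = x * z.
Proof.
move=> x0 y0 le; have [_ _ _ inj h] := hO.
have ix := iota_neq0 x0; have iy := iota_neq0 y0.
have [|z zE] := (h (iota y / iota x)).2.
  right; rewrite -(lerD2r (v (iota x))) -vM ?mulf_neq0 ?invr_neq0 //.
  by rewrite divfK // add0r.
by exists z; apply: inj; rewrite rmorphM zE mulrC divfK.
Qed.

Lemma integers_valuation_ring : valuation_ring O.
Proof.
move=> x y; have [->|x0] := eqVneq x 0; first by right; exists 0; rewrite mulr0.
have [->|y0] := eqVneq y 0; first by left; exists 0; rewrite mulr0.
have [le|/ltW le] := leP (v (iota x)) (v (iota y)).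
  by left; exact: v_dvd.
by right; exact: v_dvd.
Qed.

Lemma integers_noetherian : noetherian O.
Proof.
move=> u; have [u0|u0] := eqVneq (u 0%N) 0.
  by exists 0%N, (fun=> 0); rewrite u0 /lincomb big_ord0.
(* A nonzero term of least valuation divides its successor; on O the absolute value only turns the
   valuation into a natural number. *)
have ex : exists n, `[< exists2 i, u i != 0 & `|v (iota (u i))|%N = n >].
  by exists `|v (iota (u 0%N))|%N; apply/asboolP; exists 0%N.
case: (ex_minnP ex) => n /asboolP[i ui vi] min.
have [z uz] : exists z, u i.+1 = u i * z.
  have [->|ui'] := eqVneq (u i.+1) 0; first by exists 0; rewrite mulr0.
  apply: v_dvd => //; rewrite -(gez0_abs (v_ge0 ui)) -(gez0_abs (v_ge0 ui')) vi.
  by rewrite lez_nat; apply: min; apply/asboolP; exists i.+1.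
exists i.+1; have [_ _ M] := lincomb_ideal u i.+1.
by rewrite uz mulrC; apply/M/lincomb_mem.
Qed.

(** p has valuation e > 0, so it is not a unit. If [res p] had an inverse [res x], then one of p and
    p x - 1 would divide the other: in one case p is a unit, in the other [res p] is 0. *)
Lemma residue_char (k : fieldType) (res : {rmorphism O -> k}) :
  (forall c, exists x, res x = c) -> res p%:R = 0.
Proof.
move=> res_surj; apply/eqP; apply: contraT => rp0.
have [_ nat_val _ _] := hQp.
have [p0 vpp] := nat_val p (prime_gt0 p_prime).
have [_ _ [e e0 ram] _ _] := hO.
have ip : iota p%:R = p%:R by rewrite rmorph_nat.
have pO : (p%:R : O) != 0 by apply: contraNneq rp0 => ->; rewrite rmorph0.
have v_p : v (iota p%:R) = e.
  rewrite ip -scaler_nat -[RHS]mulr1 -(_ : vp p%:R = 1) ?ram //.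
  by rewrite vpp logn_prime // eqxx.
have p_nunit (z : O) : p%:R * z <> 1.
  move=> pz; have z0 : z != 0.
    by apply/eqP => z0; move: pz; rewrite z0 mulr0 => /esym/eqP; rewrite oner_eq0.
  have : v (iota (p%:R * z)) = e%:Z + v (iota z).
    by rewrite rmorphM -v_p; exact: (vM (iota_neq0 pO) (iota_neq0 z0)).
  rewrite pz rmorph1 v1; have := v_ge0 z0; move: e0; lia.
have [x xP] := res_surj (res p%:R)^-1.
have w0 : res (p%:R * x - 1) = 0 by rewrite rmorphB rmorphM xP mulfV // rmorph1 subrr.
have [[z e1]|[z e1]] := integers_valuation_ring p%:R (p%:R * x - 1).
  case: (p_nunit (x - z)); rewrite mulrBr -e1 opprB addrC subrK.
  by [].
by move: rp0; rewrite e1 rmorphM w0 mul0r eqxx.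
Qed.

End RingOfIntegers.

(** The powers of [x] have a cluster point, so x^i and x^j agree modulo [I] for some i < j; and 1 -
    x^(j - i) is a unit, having image 1 in k. *)
Lemma topologically_nilpotent (S : comPzRingType) (k : fieldType)
    (R : topComRingType) (sk : {rmorphism S -> k}) (iR : {rmorphism S -> R})
    (r : algHom (mkAlg iR) (mkAlg sk)) (I : set R) (x : R) :
  compact [set: R] -> local_with_residue r -> is_ideal I -> open I -> r x = 0 ->
  ideal_radical I x.
Proof.
move=> cR [_ loc] hI oI rx0; have [I0 ID IM] := hI.
pose u (n : nat) : R := x ^+ n.
have [|y [_ cl]] := cR (u @ \oo) _; first exact: filterT.
have nbhsI : nbhs y [set z | I (z - y)].
  apply: open_nbhs_nbhs; split; last by rewrite /= subrr.
  apply: (open_preimage _ oI).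
  by apply: (continuous_pair (f := id) (g := fun=> y) (@sub_continuous R)) => t;
    [exact: cvg_id|exact: cvg_cst].
have later n : exists2 m, (n <= m)%N & I (u m - y).
  have [|z [[m nm <-] Iz]] := cl (u @` [set m | (n <= m)%N]) _ _ nbhsI.
    by exists n => // m /= nm; exists m.
  by exists m.
have [i _ Ii] := later 0%N; have [j ij Ij] := later i.+1.
have [b bP] : exists b, (1 - x ^+ (j - i)) * b = 1.
  apply: loc; rewrite rmorphB rmorphXn rmorph1 rx0 expr0n subn_eq0 leqNgt ij subr0.
  exact/eqP/oner_neq0.
exists i; rewrite -[x ^+ i]mulr1 -bP mulrA mulrC; apply: IM.
rewrite mulrBr mulr1 -exprD subnKC ?(ltnW ij) //.
rewrite -[x ^+ i](subrK y) -addrA; apply: ID => //.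
by rewrite -opprB; exact: ideal_opp.
Qed.

Lemma points_eq (O : comPzRingType) (G : affineGroup O) (A : Alg O) n
    (tau : 'I_n -> coordRing G) (g h : points G A) :
  generates tau -> (forall i, pt_fun g (tau i) = pt_fun h (tau i)) -> g = h.
Proof.
move=> gen e; apply: algHom_eq => b; have [f ->] := gen b.
rewrite /poly_eval !rmorph_sum; apply: eq_bigr => t _.
rewrite !rmorphM !alghom_str !rmorph_prod; congr (_ * _).
by apply: eq_bigr => i _; rewrite !rmorphXn; congr (_ ^+ _); exact: e.
Qed.

Section ProPKernel.
Context (p : nat) (p_prime : prime p) (O : idomainType) (G : affineGroup O).
Hypotheses (vO : valuation_ring O) (nO : noetherian O) (sG : smooth (coordRing G)).
Context (k : fieldType) (res : {rmorphism O -> k}) (kbar : closedFieldType)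
  (emb : {rmorphism k -> kbar}).
Hypothesis res_p : res p%:R = 0.
Context (Gamma : topGroupType) (Thbar : pseudochar G Gamma (mkAlg res)).
Hypothesis cGamma : compact [set: Gamma].
Context (R : topComRingType) (iR : {rmorphism O -> R})
  (r : algHom (mkAlg iR) (mkAlg res)) (Thu : pseudochar G Gamma (mkAlg iR)).
Hypotheses (pR : profinite R) (loc : local_with_residue r)
  (rThu : pc_eq (pc_base_change r Thu) Thbar).
Context (rhobar : Gamma -> points G (mkAlg (emb \o res)))
  (rhobarM : {morph rhobar : x y / (x * y)%g}).
Hypothesis rhobar_Thbar :
  pc_eq (pc_of_rep rhobarM) (pc_base_change (extendHom res emb) Thbar).

Lemma condensed_pro_p_kernel (A : Alg O) (a : algHom (mkAlg iR) A)
    (rho : Gamma -> points G A) : Xgen Thu a rho ->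
  forall g, pro_p_kernel p (rhobar @^-1` [set 1%g]) g -> rho g = 1%g.
Proof.
move=> [rhoM [[n [tau [gen [M [scale [incl [hM cS [inclI inclD inclZ] [d' [m genM]]
  [c cc cE]]]]]]]] rhoThu]] g.
set K := rhobar @^-1` _ => gK.
have [d [sigma [rel sigma1]]] :=
  invariant_relation vO nO (smooth_torsion_free nO gen sG) tau.
have incl_eq x y : (forall i, incl x i = incl y i) -> x = y.
  by move=> e; apply/inclI/funext.
have incl0 i : incl 0 i = 0 by apply: (addrI (incl 0 i)); rewrite -inclD !addr0.
have sDr q x y : scale q (x + y) = scale q x + scale q y.
  by apply: incl_eq => i; rewrite !(inclZ, inclD) mulrDr.
have sDl q q' x : scale (q + q') x = scale q x + scale q' x.
  by apply: incl_eq => i; rewrite !(inclZ, inclD) rmorphD mulrDl.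
have sA q q' x : scale (q * q') x = scale q (scale q' x).
  by apply: incl_eq => i; rewrite !inclZ rmorphM mulrA.
have s1 x : scale 1 x = x by apply: incl_eq => i; rewrite inclZ rmorph1 mul1r.
have R1 : (1 : R) != 0.
  apply: contra_neq (oner_neq0 k) => e; have := rmorph1 r.
  by rewrite [X in r X]e rmorph0.
have rho1 : rho 1%g = 1%g.
  by apply: (mulgI (rho 1%g)); rewrite -rhoM !mulg1.
have rhobar1 : rhobar 1%g = 1%g.
  by apply: (mulgI (rhobar 1%g)); rewrite -rhobarM !mulg1.
have K1 : K 1%g by [].
have KM x y : K x -> K y -> K (x * y)%g.
  by rewrite /K /= => hx hy; rewrite rhobarM hx hy mulg1.
have KV x : K x -> K (x^-1)%g.
  by rewrite /K /= => hx; apply: (mulgI (rhobar x)); rewrite -rhobarM mulgV hx mulg1.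
have KX x e : K x -> K (x ^+ e)%g.
  by move=> Kx; elim: e => [|e IHe]; rewrite ?expg0 // expgS; exact: KM.
have rhoX x e : rho (x ^+ e)%g = (rho x ^+ e)%g.
  by elim: e => [|e IHe]; rewrite ?expg0 // !expgS rhoM IHe.
(* Index 0 of [Thu] stands for one variable. The images of the [P h j] in [A] are the characteristic
   coefficients of [rho h]. *)
pose P h j : R := Thu 0%N (sigma j) (fun=> h).
(* The value is computed in [kbar], where [Thbar] comes from [rhobar] and [rhobar h = 1]; [emb] is
   injective. *)
have rP h j : K h -> r (P h j) = (unipotent_coef d j)%:~R.
  move=> Kh; rewrite -[LHS]/(pc_base_change r Thu 0%N (sigma j) (fun=> h)) rThu.
  apply: (fmorph_inj emb); rewrite rmorph_int -(sigma1 (mkAlg (emb \o res))).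
  rewrite -[LHS]/(pc_base_change (extendHom res emb) Thbar 0%N (sigma j) (fun=> h)).
  rewrite -rhobar_Thbar /=.
  by have -> : rhobar \o (fun=> h) = (fun=> 1%g) :> ('I_1 -> _) by apply/funext.
have aP h j : a (P h j) = sigma j A (fun=> rho h).
  by rewrite -[LHS]/(pc_base_change a Thu 0%N (sigma j) (fun=> h)) -rhoThu.
suff cg : c g = c 1%g.
  rewrite -rho1; apply: points_eq gen _ => i; by rewrite -!cE cg.
apply: contrapT => ne.
have [|I [N [[hI oI] oN [N0 ND NZ] NI Nn]]] :=
    open_submodule sDr sDl sA cS pR hM genM (x := c g - c 1%g).
  by move=> /eqP; rewrite subr_eq0 => /eqP.
have NN x : N x -> N (- x).
  move=> /(NZ (- 1)); congr N; apply: (addrI x); rewrite subrr -{1}[x]s1 -sDl subrr.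
  exact: scale0l.
apply: Nn.
(* The condition on h = [z.2] for given y and z on its two sides. Imposed for all of them, it passes
   to products, inverses and conjugates by a change of y and z, and stays open by compactness. *)
pose W := [set z : (Gamma * Gamma) * Gamma |
  N (c (z.1.1 * z.2 * z.1.2)%g - c (z.1.1 * z.1.2)%g)].
have oW : open W.
  have mulc (f f' : (Gamma * Gamma) * Gamma -> Gamma) : continuous f -> continuous f' ->
      continuous (fun z => f z * f' z)%g.
    exact: continuous_pair (@mulg_continuous Gamma).
  have c11 : continuous (fun z : (Gamma * Gamma) * Gamma => z.1.1).
    by apply: continuous_compose; exact: continuous_fst.
  have c12 : continuous (fun z : (Gamma * Gamma) * Gamma => z.1.2).
    by apply: continuous_compose; [exact: continuous_snd|exact: continuous_fst].
  apply: (open_preimage _ oN); apply: (continuous_pair (@sub_continuous M)).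
    apply: (continuous_compose cc); apply: (mulc _ _ _ c12).
    by apply: (mulc _ _ c11); exact: continuous_snd.
  exact: (continuous_compose cc (mulc _ _ c11 c12)).
pose V := [set h : Gamma | forall t, W (t, h)].
have cGG : compact [set: Gamma * Gamma].
  by rewrite -setXTT; exact: compact_setX.
have VP h y z : V h -> N (c (y * h * z)%g - c (y * z)%g) by move=> /(_ (y, z)).
suff [_ Vg] : (K `&` V) g by have := VP g 1%g 1%g Vg; rewrite !mulg1 mul1g.
apply: gK; split.
- split.
  + split=> // t; rewrite /W /= mulg1 subrr; exact: N0.
  + move=> x y [Kx Vx] [Ky Vy]; split; first exact: KM.
    move=> [t1 t2]; rewrite /W /=.
    have := ND _ _ (VP x t1 (y * t2)%g Vx) (VP y t1 t2 Vy).
    by rewrite !mulgA addrA subrK.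
  + move=> x [Kx Vx]; split; first exact: KV.
    move=> [t1 t2]; rewrite /W /=; have := NN _ (VP x (t1 * x^-1)%g t2 Vx).
    by rewrite mulgVK opprB.
- move=> x h Kx [Kh Vh]; split; first exact: (KM _ _ (KM _ _ Kx Kh) (KV _ Kx)).
  move=> [t1 t2]; rewrite /W /=; have := VP h (t1 * x)%g (x^-1 * t2)%g Vh.
  by rewrite !mulgA mulgK.
- by exists V => //; exact: open_forall_compact.
move=> h Kh.
have cR : compact [set: R] by case: pR.
(* The operator is right translation of the first argument by [h]; the polynomial relation required
   of it is Cayley-Hamilton with coefficients [P h]. *)
have [||y|e eP] := @unipotent_power p R M scale I N (Gamma * Gamma)%type
  (fun t => (t.1 * h, t.2)%g) (fun t => c (t.1 * t.2)%g) d (P h) p_prime R1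
  sDr sDl sA s1 hI N0 ND NZ NI.
- apply: (topologically_nilpotent cR loc hI oI).
  by rewrite rmorph_nat -res_p rmorph_nat.
- move=> j; apply: (topologically_nilpotent cR loc hI oI).
  by rewrite rmorphB rmorph_int rP // subrr.
- have iterE j : iter j (fun t : Gamma * Gamma => (t.1 * h, t.2)%g) y =
      (y.1 * h ^+ j, y.2)%g.
    elim: j => [|j IHj]; first by rewrite expg0 mulg1 /=; case: (y).
    by rewrite iterS IHj /= expgSr mulgA.
  apply: incl_eq => i; rewrite incl0 -[RHS](rel A (rho y.1) (rho h) (rho y.2) i).
  have inclS l (F : 'I_l -> M) : incl (\sum_(j < l) F j) i = \sum_(j < l) incl (F j) i.
    by elim/big_rec2: _ => [|j y1 y2 _ <-].
  rewrite inclS; apply: eq_bigr => j _.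
  by rewrite inclZ aP iterE cE !rhoM rhoX.
exists e; split; first exact: KX.
move=> [t1 t2]; have := eP (t1, t2); rewrite /W /=.
suff -> : iter (p ^ e) (fun t : Gamma * Gamma => (t.1 * h, t.2)%g) (t1, t2) =
  (t1 * h ^+ (p ^ e), t2)%g by [].
elim: (p ^ e)%N => [|j IHj]; first by rewrite expg0 mulg1.
by rewrite iterS IHj /= expgSr mulgA.
Qed.

End ProPKernel.

(** * Descent to the quotient *)

(** A continuous map from a compact space onto a Hausdorff space is closed, hence a quotient map. It
    is applied to [pi], and to [phi], whose inverse is not assumed to be continuous. *)
Lemma quotient_continuous (X Y Z : topologicalType) (f : X -> Y) (g : Y -> Z) :
  compact [set: X] -> hausdorff_space Y -> continuous f ->
  (forall y, exists x, f x = y) -> continuous (g \o f) -> continuous g.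
Proof.
move=> cX hY cf f_surj cgf; apply/continuousP => U oU.
suff : closed (g @^-1` (~` U)).
  by move=> h; rewrite -[_ @^-1` U]setCK; exact: closed_openC.
rewrite (_ : g @^-1` (~` U) = f @` ((g \o f) @^-1` (~` U))).
  apply/(compact_closed hY)/continuous_compact; first exact: continuous_subspaceT.
  apply: subclosed_compact cX _ => //; apply: preimage_closed => //.
  exact: open_closedC.
apply/seteqP; split=> y; last by move=> [x gx <-].
by have [x <-] := f_surj y => gx; exists x.
Qed.

Theorem theorem1p3
  (p : nat) (p_prime : prime p)
  (Qp : fieldType) (vp : Qp -> int) (hQp : is_Qp p vp)
  (L : fieldExtType Qp) (v : L -> int)
  (O : idomainType) (iota : {rmorphism O -> L})
  (hO : is_ring_of_integers vp v iota)
  (k : fieldType) (res : {rmorphism O -> k})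
  (res_surj : forall c : k, exists x : O, res x = c)
  (kbar : closedFieldType) (emb : {rmorphism k -> kbar})
  (emb_alg : forall x : kbar, algebraicOver emb x)
  (G : affineGroup O) (hG : generalised_reductive G)
  (Gamma : topGroupType) (hGamma : profinite Gamma)
  (hPhi : mazur_Phi p Gamma)
  (Thbar : pseudochar G Gamma (mkAlg res))
  (Thbar_cont : pc_continuous setT Thbar)
  (R : topComRingType) (iR : {rmorphism O -> R})
  (r : algHom (mkAlg iR) (mkAlg res))
  (Thu : pseudochar G Gamma (mkAlg iR))
  (hR : is_universal_deformation Thbar r Thu)
  (rhobar : Gamma -> points G (mkAlg (emb \o res)))
  (rhobarM : {morph rhobar : x y / (x * y)%g})
  (rhobar_cont : forall U, open (rhobar @^-1` U))
  (rhobar_Thbar :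
     pc_eq (pc_of_rep rhobarM) (pc_base_change (extendHom res emb) Thbar))
  (Q : topGroupType) (pi : Gamma -> Q) (piM : {morph pi : x y / (x * y)%g})
  (hQ : is_pro_p_quotient p rhobar pi)
  (ThbarQ : pseudochar G Q (mkAlg res))
  (hThbarQ : pc_eq (pc_inflation piM ThbarQ) Thbar)
  (RQ : topComRingType) (iRQ : {rmorphism O -> RQ})
  (rQ : algHom (mkAlg iRQ) (mkAlg res))
  (ThuQ : pseudochar G Q (mkAlg iRQ))
  (hRQ : is_universal_deformation ThbarQ rQ ThuQ)
  (phi : algHom (mkAlg iR) (mkAlg iRQ)) (phi_cont : continuous (phi : R -> RQ))
  (hphi : pc_eq (pc_base_change phi Thu) (pc_inflation piM ThuQ))
  (psi : algHom (mkAlg iRQ) (mkAlg iR))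
  (phiK : cancel phi psi) (psiK : cancel psi phi)
  (A : Alg O) (a : algHom (mkAlg iR) A) (rho : Gamma -> points G A) :
  Xgen Thu a rho <->
  exists rhoQ : Q -> points G A, Xgen ThuQ (algComp a psi) rhoQ /\
    rho = rhoQ \o pi.
Proof.
have vO := integers_valuation_ring hO; have nO := integers_noetherian hO.
have res_p := residue_char p_prime hQp hO res_surj.
have [sG _ _] := hG; have [cGamma _ _] := hGamma.
have [pR locR _ rThu _] := hR; have [[_ hRQ' _] _ _ _ _] := hRQ.
have [[_ hQ' _] pi_cont pi_surj pi_ker] := hQ.
split=> [X|[rhoQ [[rhoQM [cond Theq]] ->]]].
  have rho_ker := condensed_pro_p_kernel p_prime vO nO sG res_p cGamma pR locR rThu
    rhobar_Thbar X.
  move: X => [rhoM [[n [tau [gen [M [scale [incl [hM cS incl_lin genM [c cc cE]]]]]]]] Theq]].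
  (* [s] need not be a homomorphism or continuous; [rho \o s] is a homomorphism because [rho] is
     constant on the fibres of [pi]. *)
  have /choice[s sP] := pi_surj.
  have rho_fact g h : pi g = pi h -> rho g = rho h.
    move=> e; apply: (mulgI (rho g^-1%g)); rewrite -!rhoM mulVg.
    have /rho_ker -> : pro_p_kernel p (rhobar @^-1` [set 1%g]) (g^-1 * h)%g.
      rewrite -pi_ker /= piM -e -piM mulVg.
      by apply: (mulgI (pi 1%g)); rewrite -piM !mulg1.
    by apply: (mulgI (rho 1%g)); rewrite -rhoM !mulg1.
  have rhoE : rho = (rho \o s) \o pi by apply/funext => g; apply: rho_fact; rewrite sP.
  exists (rho \o s); split=> //.
  have rhoQM : {morph rho \o s : x y / (x * y)%g}.
    by move=> x y /=; rewrite -rhoM; apply: rho_fact; rewrite piM !sP.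
  have psi_cont : continuous (psi : RQ -> R).
    have [cR _ _] := pR.
    apply: (quotient_continuous cR hRQ' phi_cont).
      by move=> y; exists (psi y).
    by rewrite (_ : _ \o _ = id) => [x|]; [exact: cvg_id|apply/funext => x; exact: phiK].
  exists rhoQM; split.
    (* The same module, with [RQ] acting through [psi]. *)
    exists n, tau; split=> //; exists M, (fun q => scale (psi q)), incl; split=> //.
    - apply: (continuous_pair cS); last exact: continuous_snd.
      by apply: continuous_compose psi_cont _; exact: continuous_fst.
    - by have [inclI inclD inclZ] := incl_lin; split=> // q x i; rewrite inclZ.
    - have [d [m gm]] := genM; exists d, m => x; have [b ->] := gm x.
      by exists (phi \o b); apply: eq_bigr => j _; rewrite /= phiK.
    - exists (c \o s); last by move=> q i; exact: cE.
      apply: (quotient_continuous cGamma hQ' pi_cont pi_surj).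
      rewrite (_ : _ \o _ = c) //; apply/funext => g /=.
      have [inclI _ _] := incl_lin; apply/inclI/funext => i.
      by rewrite !cE (rho_fact (s (pi g)) g) // sP.
  move=> l f gamma /=.
  (* On arguments lifted to [Gamma], [ThuQ] is the image of [Thu] under [phi], which [psi]
     undoes. *)
  have -> : gamma = pi \o (s \o gamma) by apply/funext => i; rewrite /= sP.
  rewrite -[ThuQ l f _]/(pc_inflation piM ThuQ l f (s \o gamma)) -hphi /= phiK.
  rewrite -[RHS]/(pc_base_change a Thu l f (s \o gamma)) -Theq /=.
  congr (f A _); apply/funext => i /=.
  by rewrite sP.
have rhoM : {morph rhoQ \o pi : x y / (x * y)%g}.
  by move=> x y /=; rewrite piM rhoQM.
move: cond => [n [tau [gen [M [scale [incl [hM cS [inclI inclD inclZ] [d [m genM]]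
  [c cc cE]]]]]]]].
exists rhoM; split.
  exists n, tau; split=> //; exists M, (fun q => scale (phi q)), incl; split=> //.
  - apply: (continuous_pair cS); last exact: continuous_snd.
    by apply: continuous_compose phi_cont _; exact: continuous_fst.
  - by split=> // q x i; rewrite inclZ /= phiK.
  - exists d, m => x; have [b ->] := genM x.
    by exists (psi \o b); apply: eq_bigr => j _; rewrite /= psiK.
  - exists (c \o pi); last by move=> g i; exact: cE.
    exact: continuous_compose.
move=> l f gamma.
rewrite -[LHS]/(pc_of_rep rhoQM l f (pi \o gamma)) Theq /=.
by rewrite -[ThuQ l f _]/(pc_inflation piM ThuQ l f gamma) -hphi /= phiK.
Qed.
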